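(* Let $\Sigma=\{0,1\}^{\mathbb Z}$ with left shift $T$. There exist a compact sub-shift $(X,\sigma)$ of $\{0,1\}^{\mathbb Z}$ and a Hölder continuous potential $\widehat\phi:\Sigma\times X\to\mathbb R$ with $\widehat\phi(\omega,t)=\widehat\phi(\omega_0,t_0)$ (i.e. depending only on $\omega_0$ and $t_0$) such that, for the product map $\widehat F(\omega,t):=(T\omega,\sigma t)$ on $\Sigma\times X$, no POE maximizer for $\widehat\phi$ is future independent, and in particular $$\widehat P(\widehat\phi)<\sup\Big\{h_{\widehat\eta\circ\pi^{-1}}(T)+\int\widehat\phi\,d\widehat\eta:\ \widehat\eta\text{ is an ergodic }\widehat F\text{-invariant Borel probability}\Big\}\le P(\widehat\phi),$$ where $\pi:\Sigma\times X\to\Sigma$ is the projection.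
   Context: $P(\widehat\phi)$ is the usual topological pressure of $\widehat\phi$ for $\widehat F$ on $\Sigma\times X$, i.e. $\sup\{h_{\widehat\eta}(\widehat F)+\int\widehat\phi\,d\widehat\eta\}$ over $\widehat F$-invariant Borel probabilities. Write $\widehat\phi^{(n)}=\sum_{k=0}^{n-1}\widehat\phi\circ\widehat F^k$ and $[\underline w]=\{\omega\in\Sigma:\omega_i=w_i,\ 0\le i\le n-1\}$ for a word $\underline w$ of length $n$. The pressure out of equilibrium (POE) is $$\widehat P(\widehat\phi):=\limsup_{n\to\infty}\sup_{t\in X}\frac1n\log\sum_{|\underline w|=n}e^{\widehat\phi^{(n)}(\theta_{\underline w},t)},$$ where $\theta_{\underline w}=\theta_{\underline w}(t)\in[\underline w]$ maximizes $\omega\mapsto\widehat\phi^{(n)}(\omega,t)$ on $[\underline w]$. Let $\Sigma^-=\{(\omega_i)_{i\le-1}:\omega\in\Sigma\}$ and, for $\omega^-\in\Sigma^-$, $V^u_{\le-1}(\omega^-)=\{\omega\in\Sigma:\omega_i=\omega^-_i\ \forall i\le-1\}$. Let $\widehat{\mathcal C}=\{[a]\times X\}_{a\in\{0,1\}}$ and $\widehat{\mathcal C}_n=\bigvee_{i=0}^{n-1}\widehat F^{-i}\widehat{\mathcal C}$. For an $\widehat F$-invariant Borel probability $\widehat\eta$ on $\Sigma\times X$ with disintegration $\widehat\eta=\int\eta_{(\omega^-,t)}\,d\tau(\omega^-,t)$ along $\{V^u_{\le-1}(\omega^-)\times\{t\}\}_{\omega^-\in\Sigma^-,\,t\in X}$,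 the metric entropy out of equilibrium is $$\widehat h_{\widehat\eta}(\widehat F):=\limsup_{n\to\infty}\int\frac1n \mathrm H_{\eta_{(\omega^-,t)}}(\widehat{\mathcal C}_n)\,d\tau(\omega^-,t),\qquad \mathrm H_\nu(\mathcal P)=-\sum_{A\in\mathcal P}\nu(A)\log\nu(A).$$ A POE maximizer is an $\widehat F$-invariant Borel probability on $\Sigma\times X$ attaining $\max\{\widehat h_{\widehat\eta}(\widehat F)+\int\widehat\phi\,d\widehat\eta\}$ over all $\widehat F$-invariant Borel probabilities $\widehat\eta$. Future independence: with $\eta=\widehat\eta\circ\pi^{-1}$, write $\widehat\eta=\int\widehat\eta_{\omega^-}\,d\eta^-(\omega^-)$ for the disintegration along $\{V^u_{\le-1}(\omega^-)\times X\}_{\omega^-\in\Sigma^-}$ and $\eta=\int\eta_{\omega^-}\,d\eta^-(\omega^-)$ for the disintegration of $\eta$ along $\{V^u_{\le-1}(\omega^-)\}_{\omega^-\in\Sigma^-}$, where $\eta^-$ is the projection of $\eta$ to $\Sigma^-$. $\widehat\eta$ is future independent if for $\eta^-$-a.e. $\omega^-$ the measure $\widehat\eta_{\omega^-}$ is the product of $\eta_{\omega^-}$ on $V^u_{\le-1}(\omega^-)$ and some Borel probability measure $\sigma_{\omega^-}$ on $X$. *)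

(* Defs.v *)
From HB Require Import structures.
From mathcomp Require Import all_boot all_order all_algebra.
From mathcomp Require Import all_classical all_reals all_analysis.
From mathcomp Require Import measurable_realfun.

Set Implicit Arguments.
Unset Strict Implicit.
Unset Printing Implicit Defensive.

Import Order.TTheory GRing.Theory Num.Theory.
Import numFieldNormedType.Exports.

Local Open Scope classical_set_scope.
Local Open Scope ring_scope.

(* 0-1 sequences with the product topology and its Borel sigma-algebra.  For
   countable index sets this topology is second countable, so the canonical
   product sigma-algebra on [binseq I * binseq J] is again the Borel one. *)
Definition binseq (I : Type) : Type := {ptws I -> bool}.

HB.instance Definition _ (I : Type) := Topological.on (binseq I).
HB.instance Definition _ (I : Type) := isPointed.Build (binseq I) (fun=> false).
HB.instance Definition _ (I : Type) :=
  Measurable.copy (binseq I) (g_sigma_algebraType (@open (binseq I))).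

Lemma continuous_measurable_binseq (I J : Type) (f : binseq I -> binseq J) :
  continuous f -> measurable_fun setT f.
Proof.
move=> /continuousP cf; apply: (measurability (@open (binseq J))) => //.
by move=> _ [B oB <-]; rewrite setTI; apply: sub_sigma_algebra; exact: cf.
Qed.

Notation Sigma := (binseq int).
Notation SigmaM := (binseq nat).

Definition left_shift (w : Sigma) : Sigma := fun i => w (i + 1).

(* The past (w_i)_{i <= -1}, reindexed by nat: [Negz k] is -(k+1), so the k-th
   entry of [past w] is w_{-(k+1)}.  The set V^u_{<=-1}(v) is
   [past @^-1` [set v]]. *)
Definition past (w : Sigma) : SigmaM := fun k => w (Negz k).

Lemma continuous_past : continuous past.
Proof.
move=> w; apply/cvg_sup => k U [_ [[B oB <-] /= Bk]] /filterS; apply.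
apply: (@proj_continuous _ (fun _ : int => bool) (Negz k) w B).
by apply: open_nbhs_nbhs; split.
Qed.

HB.instance Definition _ := @isMeasurableFun.Build _ _ _ _ past
  (continuous_measurable_binseq continuous_past).

Definition base (x : Sigma * Sigma) : Sigma := x.1.

Lemma measurable_base : measurable_fun setT base.
Proof. exact: measurable_fst. Qed.

HB.instance Definition _ := @isMeasurableFun.Build _ _ _ _ base
  measurable_base.

Definition past_base (x : Sigma * Sigma) : SigmaM := past x.1.

Lemma measurable_past_base : measurable_fun setT past_base.
Proof. exact: measurableT_comp. Qed.

HB.instance Definition _ := @isMeasurableFun.Build _ _ _ _ past_base
  measurable_past_base.

Definition past_fiber (x : Sigma * Sigma) : SigmaM * Sigma := (past x.1, x.2).

Lemma measurable_past_fiber : measurable_fun setT past_fiber.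
Proof. apply: measurable_fun_pair => //; exact: measurableT_comp. Qed.

HB.instance Definition _ := @isMeasurableFun.Build _ _ _ _ past_fiber
  measurable_past_fiber.

Definition subshift (X : set Sigma) : Prop :=
  [/\ X !=set0, compact X & left_shift @` X = X].

(* Measures on Sigma * X are represented by measures on Sigma * Sigma that are
   carried by [setT `*` X], and functions on Sigma * X by functions on
   Sigma * Sigma whose values off [setT `*` X] are irrelevant. *)
Definition prod_map (x : Sigma * Sigma) : Sigma * Sigma :=
  (left_shift x.1, left_shift x.2).

Definition cylinder n (w : n.-tuple bool) : set Sigma :=
  [set v | forall i : 'I_n, v (i : nat)%:Z = tnth w i].

(* 2^-N with N the least |i| such that v_i != w_i; [sup set0 = 0]. *)
Definition seq_dist (R : realType) (v w : Sigma) : R :=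
  sup [set 2^-1 ^+ absz i | i in [set i : int | v i != w i]].

Definition hoelder_on (R : realType) (X : set Sigma) (phi : Sigma * Sigma -> R)
    : Prop :=
  exists C alpha : R, 0 < alpha /\
    forall x y, X x.2 -> X y.2 ->
      `|phi x - phi y| <=
        C * (Num.max (seq_dist R x.1 y.1) (seq_dist R x.2 y.2)) `^ alpha.

Section entropy.
Context (d : measure_display) (T : measurableType d) (R : realType).

(* Finite partitions are families indexed by a finite type; empty atoms are
   harmless since [0 * ln 0 = 0]. *)
Definition part_entropy (mu : probability T R) (I : finType) (P : I -> set T)
    : R :=
  - \sum_(i : I) fine (mu (P i)) * ln (fine (mu (P i))).

Definition refinement (f : T -> T) (I : Type) (P : I -> set T) (n : nat)
    (w : n.-tuple I) : set T :=
  \bigcap_(i in [set: 'I_n]) (iter i f @^-1` P (tnth w i)).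

Definition measurable_partition (I : Type) (P : I -> set T) : Prop :=
  [/\ forall i, measurable (P i), trivIset setT P & \bigcup_i P i = setT].

(* The limit in n exists by subadditivity, for f-invariant mu. *)
Definition entropy_part (f : T -> T) (mu : probability T R) (k : nat)
    (P : 'I_k -> set T) : \bar R :=
  limn_esup (fun n => (n%:R^-1 *
    part_entropy mu (fun w : n.-tuple 'I_k => refinement f P w))%:E).

Definition ks_entropy (f : T -> T) (mu : probability T R) : \bar R :=
  ereal_sup [set h | exists k (P : 'I_k -> set T),
    measurable_partition P /\ h = entropy_part f mu P].

End entropy.

Section disintegration.
Context (d d' : measure_display) (T : measurableType d) (Y : measurableType d')
  (R : realType) (mu : probability T R) (p : {mfun T >-> Y}).

(* [k] disintegrates [mu] along the fibres of [p]; the quotient measure is the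
   projection [distribution mu p]. *)
Definition is_disintegration (k : Y -> probability T R) : Prop :=
  [/\ forall A, measurable A -> measurable_fun setT (k ^~ A),
      forall A, measurable A -> mu A = (\int[distribution mu p]_y k y A)%E
    & {ae distribution mu p, forall y, k y (p @^-1` [set y]) = 1%E}].

(* On the (standard Borel) sequence spaces below a disintegration exists and is
   unique up to a null set of [y], so the choice made here is immaterial. *)
Definition disintegration : Y -> probability T R :=
  [get k | is_disintegration k].

End disintegration.

Section pressure.
Context (R : realType) (X : set Sigma).
Implicit Types (phi : Sigma * Sigma -> R) (eta : probability (Sigma * Sigma)%type R).

Definition invariant eta : Prop :=
  eta (setT `*` X) = 1%E /\
  forall A, measurable A -> eta (prod_map @^-1` A) = eta A.

Definition ergodic eta : Prop :=
  invariant eta /\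
  forall A, measurable A -> prod_map @^-1` A = A -> eta A = 0%E \/ eta A = 1%E.

Definition energy phi eta : \bar R :=
  (\int[eta]_(x in setT `*` X) (phi x)%:E)%E.

Definition top_pressure phi : \bar R :=
  ereal_sup [set (ks_entropy prod_map eta + energy phi eta)%E
            | eta in invariant].

Definition birkhoff phi n (x : Sigma * Sigma) : R :=
  \sum_(k < n) phi (iter k prod_map x).

(* theta_w(t) *)
Definition cyl_argmax phi n (w : n.-tuple bool) (t : Sigma) : Sigma :=
  [get v | cylinder w v /\
    forall v', cylinder w v' -> birkhoff phi n (v', t) <= birkhoff phi n (v, t)].

Definition poe phi : \bar R :=
  limn_esup (fun n => ereal_sup
    [set (n%:R^-1 * ln (\sum_(w : n.-tuple bool)
                          expR (birkhoff phi n (cyl_argmax phi w t, t))))%:E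
    | t in X]).

Definition symbol_part (a : bool) : set (Sigma * Sigma) :=
  [set v | v 0 = a] `*` X.

Definition poe_entropy eta : \bar R :=
  limn_esup (fun n => (\int[distribution eta past_fiber]_y
    (n%:R^-1 * part_entropy (disintegration eta past_fiber y)
       (fun w : n.-tuple bool => refinement prod_map symbol_part w))%:E)%E).

Definition poe_maximizer phi eta : Prop :=
  invariant eta /\
  forall eta', invariant eta' ->
    (poe_entropy eta' + energy phi eta' <= poe_entropy eta + energy phi eta)%E.

Definition future_independent eta : Prop :=
  {ae distribution (distribution eta base) past, forall v,
    exists sigma : probability Sigma R, sigma X = 1%E /\
      forall A, measurable A ->
        disintegration eta past_base v A =
        (disintegration (distribution eta base) past v \x sigma)%E A}.

End pressure.

(* Main.v *)
Require Import Defs.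
From mathcomp Require Import all_boot zify.

Set Implicit Arguments.
Unset Strict Implicit.
Unset Printing Implicit Defensive.

(* The potential is [K] times the indicator of [w_0 = t_0] with [K] large, and
   [X] is a subshift, in the spirit of Grillenberger, all of whose invariant
   measures have positive entropy: the blocks of level [k + 1] are the
   concatenations of all the blocks of level [k], each used once, in an
   arbitrary order.

   A word of length [2 l_k] occurs in a sequence of [X] with frequency at most
   [3 / N_k], where the number [N_k] of blocks of level [k] is exponentially
   large in their length [l_k].  Moreover all the words have uniform
   frequencies in [X], which gives an ergodic measure [mu] on [X] of positive
   entropy.  The diagonal measure over [mu] yields the value [h (mu) + K], which
   exceeds [ln (1 + e^K)], a bound of the POE.

   The diagonal measure also shows that a POE maximizer satisfies [w_0 = t_0]
   outside of a set of measure [O (1 / K)].  If it is future independent, then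
   [w_0] and [t_0] are independent given the past of [w], and two independent
   bits that agree with high probability are almost deterministic: they are
   predicted by the past of [w], hence by a finite part of it, with a small
   error.  The word [t_0 ... t_{n-1}] is then coded by boundedly many bits and
   the few positions where the prediction or the agreement fails.  There are too
   few such codes, given the bound on the probability of each single word. *)

(** * Blocks built from permutations *)

Fixpoint blocks (k : nat) : seq (seq bool) :=
  if k is k'.+1 then [seq flatten ss | ss <- permutations (blocks k')]
  else [seq val t | t : 5.-tuple bool].

Fixpoint blen (k : nat) : nat :=
  if k is k'.+1 then size (blocks k') * blen k' else 5.

Lemma shape_blocks l (ss : seq (seq bool)) :
  (forall w, w \in ss -> size w = l) -> shape ss = nseq (size ss) l.
Proof.
move=> h; rewrite -(size_map size ss); apply/all_pred1P/allP.
by move=> _ /mapP[w wss ->]; apply/eqP/h.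
Qed.

Lemma size_blocks_mem k w : w \in blocks k -> size w = blen k.
Proof.
elim: k w => [|k IH] w /=; first by case/mapP => t _ ->; rewrite size_tuple.
case/mapP => ss; rewrite mem_permutations => ssW ->.
rewrite size_flatten (@shape_blocks (blen k)) ?sumn_nseq.
  by rewrite (perm_size ssW) mulnC.
by move=> v; rewrite (perm_mem ssW); exact: IH.
Qed.

(** Since all blocks of level [k] have the same length, a concatenation can be cut back into its
    factors, so different orders give different words. *)
Lemma blocks_uniq k : uniq (blocks k).
Proof.
case: k => [|k]; first by rewrite map_inj_uniq ?enum_uniq//; exact: val_inj.
rewrite map_inj_in_uniq ?permutations_uniq// => s1 s2.
rewrite !mem_permutations => p1 p2 e.
have sh s : perm_eq s (blocks k) -> shape s = nseq (size (blocks k)) (blen k).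
  move=> p; rewrite (@shape_blocks (blen k)) ?(perm_size p)//.
  by move=> v; rewrite (perm_mem p); exact: size_blocks_mem.
by rewrite -(flattenK s1) -(flattenK s2) e !sh.
Qed.

Lemma size_blocksS k : size (blocks k.+1) = (size (blocks k))`!.
Proof. by rewrite size_map size_permutations ?blocks_uniq. Qed.

(** A weak form of Stirling's formula: [n ^ n] is at most the falling factorial of [2 n], which is a
    central binomial coefficient times [n!]. *)
Lemma exp_self_le_fact n : n ^ n <= 4 ^ n * n`!.
Proof.
have le1 : n ^ n <= (n + n) ^_ n.
  rewrite ffact_prod -[X in _ ^ X]card_ord -prod_nat_const.
  by apply: leq_prod => i _; have := ltn_ord i; lia.
have le2 : 'C(n + n, n) <= 4 ^ n.
  rewrite -[4]/(2 ^ 2) -expnM mul2n -addnn -[2]/(1 + 1) expnDn.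
  have hn : n < (n + n).+1 by lia.
  rewrite (bigD1 (Ordinal hn)) //= !exp1n !muln1; exact: leq_addr.
by rewrite (leq_trans le1)// -bin_ffact leq_mul2r le2 orbT.
Qed.

(** The number of blocks is exponential in their length. With [a = 2 ^ (l / 5)] and [N >= 16 a], the
    factorial bound gives [N! >= (N / 4) ^ N >= (4 a) ^ N], while [a ^ N] is the power of 2 for the
    new length [N * l]. The factor 16 pays for the loss of 4 and renews itself because
    [4 ^ N >= 16]; at level 0 it is exact, [16 * 2 = 32]. *)
Lemma blen_size_blocks k :
  (5 %| blen k) && (16 * 2 ^ (blen k %/ 5) <= size (blocks k)).
Proof.
elim: k => [|k /andP[d5 IH]].
  by rewrite /= size_map -cardT card_tuple card_bool.
rewrite size_blocksS /=; set N := size (blocks k) in IH *.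
rewrite dvdn_mull//= -muln_divA// [N * _]mulnC expnM.
set a := 2 ^ _ in IH *.
have a0 : 0 < a by rewrite expn_gt0.
have N16 : 16 <= N by apply: leq_trans IH; rewrite leq_pmulr.
rewrite -(@leq_pmul2l (4 ^ N)) ?expn_gt0//.
apply: leq_trans (exp_self_le_fact N).
have h : (16 * a) ^ N <= N ^ N by rewrite leq_exp2r//; lia.
apply: leq_trans h; rewrite -[16]/(4 * 4) !expnMn -!mulnA leq_mul// mulnA leq_mul//.
by apply: (@leq_trans (4 ^ 2)) => //; rewrite leq_exp2l//; lia.
Qed.

Lemma size_blocks_ge16 k : 16 <= size (blocks k).
Proof.
have /andP[_] := blen_size_blocks k; apply: leq_trans.
by rewrite leq_pmulr// expn_gt0.
Qed.

Lemma blen_gt k : k < blen k.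
Proof.
elim: k => [//|k IH] /=; have := size_blocks_ge16 k.
move=> N16; rewrite (leq_trans _ (leq_mul N16 (leqnn _)))//; lia.
Qed.

Lemma blen_gt0 k : 0 < blen k.
Proof. exact: leq_ltn_trans (blen_gt k). Qed.

(** * Windows and parsings into blocks *)

Definition window (u : nat -> bool) (p l : nat) : seq bool :=
  [seq u (p + i) | i <- iota 0 l].

Lemma size_window u p l : size (window u p l) = l.
Proof. by rewrite size_map size_iota. Qed.

Lemma nth_window u p l i : i < l -> nth false (window u p l) i = u (p + i).
Proof. by move=> il; rewrite (nth_map 0) ?size_iota// nth_iota. Qed.

Lemma window_sub u p l a b : a + b <= l ->
  window u (p + a) b = take b (drop a (window u p l)).
Proof.
move=> abl; apply: (@eq_from_nth _ false).
  by rewrite size_take size_drop !size_window; case: ltnP; lia.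
move=> i; rewrite size_window => ib.
by rewrite nth_window// nth_take// nth_drop nth_window ?addnA//; lia.
Qed.

Lemma eq_window u v p q l : (forall i, i < l -> u (p + i) = v (q + i)) ->
  window u p l = window v q l.
Proof.
move=> h; apply: (@eq_from_nth _ false); rewrite ?size_window// => i il.
by rewrite !nth_window// h.
Qed.

(* The length [n] bounds the part of [u] that is looked at, so that the
   condition only involves finitely many coordinates; the incomplete words at
   both ends are unconstrained. *)
Definition parsed (k n : nat) (u : nat -> bool) : Prop :=
  exists2 r, r <= blen k & forall j, r + j.+1 * blen k <= n ->
    window u (r + j * blen k) (blen k) \in blocks k.

Lemma eq_parsed k n u v : (forall i, i < n -> u i = v i) ->
  parsed k n u -> parsed k n v.
Proof.
move=> uv [r rk h]; exists r => // j jn; 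
rewrite -(@eq_window u v (r + j * blen k) (r + j * blen k)) ?h// => i il.
by apply: uv; rewrite (leq_trans _ jn)// mulSn; lia.
Qed.

Lemma take_drop_flatten l (ss : seq (seq bool)) i :
  (forall w, w \in ss -> size w = l) -> i < size ss ->
  take l (drop (i * l) (flatten ss)) = nth [::] ss i.
Proof.
elim: ss i => [//|w ss IH] [|i] /= h.
  by rewrite mul0n drop0 take_size_cat// h ?mem_head.
rewrite mulSn drop_cat (h w) ?mem_head// ltnS [_ < l]ltnNge leq_addr/= addKn => i_ss.
by rewrite IH// => v vss; apply: h; rewrite inE vss orbT.
Qed.

Lemma block_split k w : w \in blocks k.+1 ->
  exists2 ss, perm_eq ss (blocks k) & forall i, i < size (blocks k) ->
    take (blen k) (drop (i * blen k) w) = nth [::] ss i.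
Proof.
case/mapP => ss; rewrite mem_permutations => p ->; exists ss => // i iN.
apply: take_drop_flatten; last by rewrite (perm_size p).
by move=> v; rewrite (perm_mem p); exact: size_blocks_mem.
Qed.

Lemma window_block_split k u p : window u p (blen k.+1) \in blocks k.+1 ->
  exists2 ss, perm_eq ss (blocks k) & forall i, i < size (blocks k) ->
    window u (p + i * blen k) (blen k) = nth [::] ss i.
Proof.
move=> /block_split[ss pss h]; exists ss => // i iN.
rewrite -h// -window_sub// addnC -mulSn leq_mul//.
Qed.

(** A window of length [2 l] contains a complete slot of the level-[k] parsing. Its offset in the
    window determines the block of level [k] read there, and that block occurs only once in the
    surrounding block of level [k + 1]. Hence a position where [s] occurs is determined by one of
    [l] offsets and one of 3 surrounding blocks. *)
Lemma word_rare k n u s : 4 * blen k.+1 <= n -> parsed k.+1 n u ->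
  \sum_(i < blen k.+1) (window u (blen k.+1 + i) (2 * blen k) == s)
    <= 3 * blen k.
Proof.
move=> nL [r rL h].
set L := blen k.+1 in nL rL h *; set l := blen k; set N := size (blocks k).
have LE : L = N * l by [].
have N0 : 0 < N by have := size_blocks_ge16 k; rewrite -/N; lia.
have l0 : 0 < l := blen_gt0 k.
have lL : l <= L by rewrite LE leq_pmull.
(* [c i] numbers the first slot of level [k] starting at or after [L + i], a division rounded up,
   and [d i] is its distance from there. Positions are counted from [L] so that they are not before
   [r]. *)
pose c i := (L + i - r + l.-1) %/ l.
pose d i := r + c i * l - (L + i).
have cP i : L + i <= r + c i * l < L + i + l.
  have := divn_eq (L + i - r + l.-1) l; rewrite -/(c i).
  by have := ltn_pmod (L + i - r + l.-1) l0; lia.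
have jP i : i < L -> c i %/ N < 3.
  move=> iL; rewrite ltn_divLR// -(ltn_pmul2r l0) -mulnA -LE.
  by have := cP i; lia.
pose A := [pred i : 'I_L | window u (L + i) (2 * l) == s].
(* The pair of the offset [d i < l] and the index [c i %/ N < 3] is packed into one number below
   [3 * l]. *)
rewrite -big_mkcond/= sum1_card -(size_image (fun i : 'I_L => d i * 3 + c i %/ N) A).
rewrite -[3 * l](size_iota 0); apply: uniq_leq_size; last first.
  move=> _ /mapP[i _ ->]; rewrite mem_iota /= add0n.
  have dl : d i < l by rewrite /d; have := cP i; lia.
  by have := jP i (ltn_ord i); move: dl; move: (d i) (_ %/ _) => x y; lia.
rewrite map_inj_in_uniq ?enum_uniq// => i1 i2.
rewrite !mem_enum !inE => /eqP s1 /eqP s2 e.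
have [j1 j2] := (jP i1 (ltn_ord i1), jP i2 (ltn_ord i2)).
have [ed ej] : d i1 = d i2 /\ c i1 %/ N = c i2 %/ N.
  by move: e j1 j2; move: (d _) (_ %/ _) (d _) (_ %/ _) => x1 y1 x2 y2; lia.
have slot i : i < L -> window u (L + i) (2 * l) = s ->
    window u (r + c i * l) l = take l (drop (d i) s).
  move=> iL <-; rewrite -window_sub; last by rewrite /d; have := cP i; lia.
  by congr window; rewrite /d; have := cP i; lia.
have hj : r + (c i1 %/ N).+1 * L <= n.
  apply: leq_trans nL; rewrite (mulnDl 1 3) mul1n leq_add//.
  by rewrite leq_mul2r j1 orbT.
have [ss pss hss] := window_block_split (h _ hj).
have slot' i : i < L -> c i %/ N = c i1 %/ N ->
    window u (r + c i * l) l = nth [::] ss (c i %% N).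
  move=> iL ei; rewrite -hss ?ltn_mod// -addnA; congr (window _ (_ + _) _).
  by rewrite -ei [in LHS](divn_eq (c i) N) mulnDl -mulnA.
have : nth [::] ss (c i1 %% N) = nth [::] ss (c i2 %% N).
  by rewrite -!slot'// !slot// ed.
move/eqP; rewrite nth_uniq ?(perm_size pss) ?ltn_mod//; last first.
  by rewrite (perm_uniq pss) blocks_uniq.
move=> /eqP em; apply: val_inj => /=.
have ec : c i1 = c i2 by rewrite (divn_eq (c i1) N) (divn_eq (c i2) N) ej em.
by move: ed (cP i1) (cP i2); rewrite /d ec; lia.
Qed.

(** * Visit counts along blocks *)

Definition visits (phi : seq bool -> bool) (u : nat -> bool) (m a n : nat) :=
  \sum_(i < n) phi (window u (a + i) m).

Lemma visits_cat phi u m a n1 n2 :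
  visits phi u m a (n1 + n2) = visits phi u m a n1 + visits phi u m (a + n1) n2.
Proof.
rewrite /visits big_split_ord; congr (_ + _).
by apply: eq_bigr => i _; rewrite addnA.
Qed.

Lemma sum_bool_le n (b : 'I_n -> bool) : \sum_(i < n) b i <= n.
Proof.
rewrite (leq_trans (leq_sum _ (fun i _ => leq_b1 _)))//.
by rewrite sum_nat_const card_ord muln1.
Qed.

Lemma visits_le phi u m a n : visits phi u m a n <= n.
Proof. exact: sum_bool_le. Qed.

Lemma visits_mul phi u m a n l :
  visits phi u m a (n * l) = \sum_(i < n) visits phi u m (a + i * l) l.
Proof.
elim: n => [|n IH]; first by rewrite /visits !big_ord0.
by rewrite mulSn addnC visits_cat IH big_ord_recr.
Qed.

(* Each block of level [k+1] contains every block of level [k] exactly once, so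
   that up to boundary effects the number of visits along a block of level
   [k+1] is the same for all blocks. *)
Lemma visits_uniform phi m k : exists2 c, c <= blen k.+1 &
  forall u n j, n.+1 * blen k.+1 <= j -> parsed k.+1 j u ->
  n * c <= visits phi u m 0 (n * blen k.+1) + blen k.+1 /\
  visits phi u m 0 (n * blen k.+1)
    <= n * c + blen k.+1 + n * (size (blocks k) * m).
Proof.
set L := blen k.+1; set l := blen k; set N := size (blocks k).
(* Only starting points whose window stays inside the block are counted, so that the count depends
   on the word [b] alone; at most [m] starting points per block are left out. *)
pose inner b := \sum_(o < l - m) phi (take m (drop o b)).
have inner_le b : inner b <= l.
  by rewrite (leq_trans (sum_bool_le _))// leq_subr.
have innerP u p : inner (window u p l) <= visits phi u m p l
    <= inner (window u p l) + m.
  have [ml|lm] := leqP m l; last first.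
    rewrite /inner (_ : l - m = 0) ?big_ord0//=; last by lia.
    by rewrite (leq_trans (visits_le _ _ _ _ _))// ltnW.
  rewrite -{2 3}(subnK ml) visits_cat.
  have -> : visits phi u m p (l - m) = inner (window u p l).
    apply: eq_bigr => o _; rewrite -window_sub//.
    by have := ltn_ord o; lia.
  by rewrite leq_addr leq_add2l visits_le.
exists (\sum_(b <- blocks k) inner b) => [|u n j nj [r rL h]].
  rewrite (leq_trans (leq_sum _ (fun b _ => inner_le b)))//.
  by rewrite big_const_seq count_predT iter_addn_0 mulnC.
set c := \sum_(b <- _) _.
have cL : c <= L.
  rewrite (leq_trans (leq_sum _ (fun b _ => inner_le b)))//.
  by rewrite big_const_seq count_predT iter_addn_0 mulnC.
have superP i : i < n -> c <= visits phi u m (r + i * L) L <= c + N * m.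
  move=> iln.
  have hi : r + i.+1 * L <= j.
    by apply: leq_trans nj; rewrite [n.+1 * _]mulSn leq_add// leq_mul2r iln orbT.
  have [ss pss hss] := window_block_split (h _ hi).
  have sN : size ss = N by rewrite (perm_size pss).
  have cE : c = \sum_(a < N) inner (nth [::] ss a).
    by rewrite /c -(perm_big _ pss)/= (big_nth [::]) big_mkord sN.
  rewrite {2}/L /= -/N -/l visits_mul cE.
  have -> : \sum_(a < N) inner (nth [::] ss a) + N * m
      = \sum_(a < N) (inner (nth [::] ss a) + m).
    by rewrite big_split/= sum_nat_const card_ord.
  apply/andP; split; apply: leq_sum => a _; rewrite -hss//;
    by case/andP: (innerP u (r + i * L + a * l)).
have lo : n * c <= visits phi u m r (n * L).
  rewrite visits_mul -[X in X * c]card_ord -sum_nat_const.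
  by apply: leq_sum => i _; case/andP: (superP i (ltn_ord i)).
have hi : visits phi u m r (n * L) <= n * (c + N * m).
  rewrite visits_mul -[X in X * (_ + _)]card_ord -sum_nat_const.
  by apply: leq_sum => i _; case/andP: (superP i (ltn_ord i)).
(* Moving the start of the count from [r] to 0 exchanges two stretches of length [r <= L]. *)
have e1 := visits_cat phi u m 0 r (n * L).
have e2 := visits_cat phi u m 0 (n * L) r.
have e3 := visits_le phi u m 0 r; have e4 := visits_le phi u m (n * L) r.
rewrite !add0n in e1 e2; rewrite [r + _]addnC in e1.
by move: hi; rewrite mulnDr; lia.
Qed.

(** A periodic repetition of [w] is cut into blocks of level [k] at the multiples of [blen k], hence
    by downward induction into blocks of level [j] at the multiples of [blen j]. *)
Lemma periodic_parsed k w b j n : w \in blocks k -> j <= k ->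
  parsed j n (fun i => nth false w ((b + i) %% blen k)).
Proof.
move=> wk jk; pose v i := nth false w (i %% blen k).
have vP c : window v (c * blen j) (blen j) \in blocks j.
  move: c; elim: {jk}(k - j) {-2}j (subnKC jk) => [|d IH] i ik c.
    rewrite addn0 in ik; rewrite ik (_ : window _ _ _ = w)//.
    apply: (@eq_from_nth _ false); rewrite ?size_window ?(size_blocks_mem wk)//.
    by move=> a al; rewrite nth_window// /v modnMDl modn_small.
  have [] := @window_block_split i v (c %/ size (blocks i) * blen i.+1).
    by apply: IH; lia.
  move=> ss pss /(_ (c %% size (blocks i))).
  have N0 : 0 < size (blocks i) by have := size_blocks_ge16 i; lia.
  rewrite ltn_mod N0 => /(_ isT); rewrite /= mulnA -mulnDl -divn_eq => ->.
  by rewrite -(perm_mem pss) mem_nth// (perm_size pss) ltn_mod.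
(* The distance from [b] to the next multiple of [blen j]; it equals [blen j] when [b] is itself a
   multiple, a value that [parsed] allows. *)
exists (blen j - b %% blen j) => [|c _]; first exact: leq_subr.
rewrite (@eq_window _ v _ ((b %/ blen j).+1 * blen j + c * blen j)).
  by rewrite -mulnDl; exact: vP.
move=> i _; rewrite /v; congr (nth _ _ (_ %% _)); rewrite !addnA; congr (_ + _ + _).
have := ltn_pmod b (blen_gt0 j); have := divn_eq b (blen j).
by rewrite mulSn; lia.
Qed.

From mathcomp Require Import all_boot all_order all_algebra.
From mathcomp Require Import all_classical all_reals all_analysis.
From mathcomp Require Import measurable_realfun lra ring zify.

Import Order.TTheory GRing.Theory Num.Theory.
Import numFieldNormedType.Exports.

Local Open Scope classical_set_scope.
Local Open Scope ring_scope.

(** * Borel sets and measures on spaces of 0-1 sequences *)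

Section finite_dependence.
Context (I : countType).
Implicit Types (s : seq I) (E A : set (binseq I)) (t : binseq I).

Definition findep s E := forall t t', {in s, t =1 t'} -> E t -> E t'.

Lemma findepC s E : findep s E -> findep s (~` E).
Proof.
move=> h t t' tt' + Et'; apply.
by apply: h Et' => i si; rewrite tt'.
Qed.

Lemma findepI s1 s2 E1 E2 : findep s1 E1 -> findep s2 E2 ->
  findep (s1 ++ s2) (E1 `&` E2).
Proof.
move=> h1 h2 t t' tt' [E1t E2t]; split.
- by apply: h1 E1t => i si; apply: tt'; rewrite mem_cat si.
- by apply: h2 E2t => i si; apply: tt'; rewrite mem_cat si orbT.
Qed.

(** The sets on the right form a filter that contains the subbasic neighbourhoods of the product
    topology; conversely each is a finite intersection of conditions on one coordinate. *)
Lemma nbhs_findep t (A : set (binseq I)) :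
  nbhs t A <-> exists s, forall t', {in s, t =1 t'} -> A t'.
Proof.
split=> [nA|[s]].
  pose G : set_system (binseq I) :=
    [set A | exists s, forall t', {in s, t =1 t'} -> A t'].
  have GF : Filter G.
    split.
    - by exists [::].
    - move=> P Q [s1 h1] [s2 h2]; exists (s1 ++ s2) => t' tt'; split.
      + by apply: h1 => i si; apply: tt'; rewrite mem_cat si.
      + by apply: h2 => i si; apply: tt'; rewrite mem_cat si orbT.
    - by move=> P Q PQ [s h]; exists s => t' /h/PQ.
  suff : G --> t by apply.
  apply/cvg_sup => k U [_ [[B oB <-] /= Bk]] /filterS; apply.
  by exists [:: k] => t' tt'; rewrite /= -tt' ?inE.
elim: s A => [A h|i s IH A h]; first by apply: filterS filterT => t' _; exact: h.
have nS : nbhs t [set t' | {in s, t =1 t'}] by apply: IH => t'.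
have ni : nbhs t [set t' : binseq I | t i = t' i].
  have := @proj_continuous I (fun=> bool) i t [set b | t i = b].
  by apply; apply/principal_filterP.
apply: filterS (filterI nS ni) => t' [h1 h2]; apply: h => j.
by rewrite inE => /predU1P[->//|]; exact: h1.
Qed.

Lemma open_findep s E : findep s E -> open E.
Proof.
move=> h; rewrite openE => t Et; apply/nbhs_findep; exists s => t' tt'.
exact: h Et.
Qed.

Lemma closed_findep s E : findep s E -> closed E.
Proof. by move=> /findepC/open_findep/open_closedC; rewrite setCK. Qed.

Lemma measurable_open (A : set (binseq I)) : open A -> measurable A.
Proof. exact: sub_sigma_algebra. Qed.

Lemma measurable_findep s E : findep s E -> measurable E.
Proof. by move/open_findep; exact: measurable_open. Qed.

Definition finite_sets : set (set (binseq I)) := [set E | exists s, findep s E].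

(** An open set is the union of the cylinders inside it, and these are countably many: a cylinder is
    coded by a finite list of pairs of an index and a bit. *)
Lemma open_sub_finite_sets (O : set (binseq I)) : open O -> <<s finite_sets >> O.
Proof.
move=> oO.
pose cyl (p : seq (I * bool)) : set (binseq I) :=
  [set t | forall q, q \in p -> t q.1 = q.2].
pose F n := if unpickle n is Some p then [set t | cyl p `<=` O /\ cyl p t]
            else set0.
have -> : O = \bigcup_n F n.
  apply/seteqP; split=> t; last first.
    by case=> n _; rewrite /F; case: unpickle => // p [pO]; exact: pO.
  move=> Ot; have /nbhs_findep[s h] : nbhs t O by exact: open_nbhs_nbhs.
  pose p := [seq (i, t i) | i <- s].
  exists (pickle p) => //; rewrite /F pickleK; split.
    move=> t' tp; apply: h => i si; apply/esym/(tp (i, t i)).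
    by apply/mapP; exists i.
  by move=> q /mapP[i _ ->].
apply: (@bigcupT_measurable _ (g_sigma_algebraType finite_sets)) => n.
apply: sub_sigma_algebra; rewrite /F.
case: unpickle => [p|]; last by exists [::].
exists [seq q.1 | q <- p] => t t' tt' [pO pt]; split=> // q qp.
by rewrite -tt' ?pt//; apply/mapP; exists q.
Qed.

Lemma measurable_binseqE : @measurable _ (binseq I) = <<s finite_sets >>.
Proof.
apply/seteqP; split.
- apply: smallest_sub; first exact: smallest_sigma_algebra.
  exact: open_sub_finite_sets.
- apply: smallest_sub; first exact: sigma_algebra_measurable.
  by move=> E [s h]; exact: measurable_findep h.
Qed.

(** By induction on the support: the value of one coordinate cuts a finitely dependent set into two
    pieces whose remaining condition has a smaller support. *)
Lemma measurable_to_binseq d (T : measurableType d) (f : T -> binseq I) :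
  (forall i, measurable [set x | f x i]) -> measurable_fun setT f.
Proof.
move=> mf; apply: (@measurability _ _ _ _ _ _ finite_sets).
  exact: measurable_binseqE.
move=> _ [E [s h] <-]; rewrite setTI.
elim: s E h => [|i s IH] E h.
  have [->|/set0P[t Et]] := eqVneq E set0; first by rewrite preimage_set0.
  have -> : E = setT by apply/seteqP; split=> // t' _; exact: h Et.
  by rewrite preimage_setT.
pose Eb b : set (binseq I) := [set t | E (fun j => if j == i then b else t j)].
have hb b : findep s (Eb b).
  move=> t t' tt'; apply: h => j; rewrite inE; case: eqP => //= _; exact: tt'.
have -> : f @^-1` E = ([set x | f x i] `&` f @^-1` Eb true)
    `|` (~` [set x | f x i] `&` f @^-1` Eb false).
  apply/seteqP; split=> x /=.
    move=> Ex; case fxi : (f x i); [left|right]; split => //; apply: h Ex => j;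
      by rewrite inE; case: eqP => [->//|].
  case=> -[fxi]; apply: h => j _; case: eqP => [->|//].
    by rewrite fxi.
  by apply/esym/negbTE/negP.
apply: measurableU; apply: measurableI.
- exact: mf.
- exact: IH (hb _).
- exact/measurableC/mf.
- exact: IH (hb _).
Qed.

End finite_dependence.

(** * Real-valued masses of events *)

Section real_valued_probability.
Context d (T : measurableType d) (R : realType) (P : probability T R).
Implicit Types A B : set T.

Definition pr A : R := fine (P A).

Lemma prE A : measurable A -> P A = (pr A)%:E.
Proof. by move=> mA; rewrite /pr fineK// fin_num_measure. Qed.

Lemma pr_ge0 A : 0 <= pr A.
Proof. exact: fine_ge0. Qed.

Lemma prT : pr setT = 1.
Proof. by rewrite /pr probability_setT. Qed.

Lemma pr0 : pr set0 = 0.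
Proof. by rewrite /pr measure0. Qed.

Lemma pr_le A B : measurable A -> measurable B -> A `<=` B -> pr A <= pr B.
Proof.
by move=> mA mB AB; rewrite -lee_fin -!prE// le_measure// inE.
Qed.

Lemma pr_le1 A : measurable A -> pr A <= 1.
Proof. by move=> mA; rewrite -prT; exact: pr_le. Qed.

Lemma prU_le A B : measurable A -> measurable B -> pr (A `|` B) <= pr A + pr B.
Proof.
move=> mA mB; rewrite -lee_fin EFinD -!prE//; last exact: measurableU.
exact: measureU2.
Qed.

Lemma prU A B : measurable A -> measurable B -> A `&` B = set0 ->
  pr (A `|` B) = pr A + pr B.
Proof.
move=> mA mB AB; apply: EFin_inj; rewrite EFinD -!prE//; last exact: measurableU.
exact: measureU.
Qed.

Lemma pr_split A B : measurable A -> measurable B ->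
  pr A = pr (A `&` B) + pr (A `&` ~` B).
Proof.
move=> mA mB; rewrite -prU; first by rewrite -setIUr setUv setIT.
- exact: measurableI.
- by apply: measurableI => //; exact: measurableC.
- by rewrite setIACA setICr setI0.
Qed.

Lemma prC A : measurable A -> pr (~` A) = 1 - pr A.
Proof.
by move=> mA; rewrite -prT (pr_split measurableT mA) !setTI addrC addKr.
Qed.

Lemma pr_sum_fiber (J : finType) (f : T -> J) A : measurable A ->
  (forall j, measurable [set x | f x = j]) ->
  pr A = \sum_j pr (A `&` [set x | f x = j]).
Proof.
move=> mA mf.
have mB (r : seq J) : measurable (A `&` [set x | f x \in r]).
  apply: measurableI => //; elim: r => [|j r IH].
    by rewrite (_ : mkset _ = set0)//; apply/seteqP; split.
  rewrite (_ : mkset _ = [set x | f x = j] `|` [set x | f x \in r]).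
    exact: measurableU.
  apply/seteqP; split=> x; rewrite /= inE; first by move=> /predU1P.
  by move=> h; apply/predU1P.
have h (r : seq J) : uniq r -> pr (A `&` [set x | f x \in r])
    = \sum_(j <- r) pr (A `&` [set x | f x = j]).
  elim: r => [_|j r IH /= /andP[jr ur]].
    rewrite big_nil (_ : _ `&` _ = set0) ?pr0//.
    by apply/seteqP; split=> // x [].
  rewrite big_cons -IH// -prU//; first last.
  - apply/seteqP; split=> // x [[_ /= fx] [_ /= fxr]].
    by move: jr; rewrite -fx fxr.
  - exact: measurableI.
  congr pr; rewrite -setIUr; congr (_ `&` _); apply/seteqP; split=> x /=.
    by rewrite inE => /predU1P.
  by move=> h; rewrite inE; apply/predU1P.
rewrite -big_enum/= -h ?enum_uniq//; congr pr; apply/seteqP.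
by split=> x; [move=> Ax; split=> //=; rewrite mem_enum|case].
Qed.

End real_valued_probability.

Section measures_on_sequences.
Context (I : countType) (R : realType).
Implicit Types (P Q : probability (binseq I) R).

(** The finitely dependent sets are a generating class, stable under intersection and containing the
    whole space. *)
Lemma eq_probability_findep P Q :
  (forall s E, findep s E -> P E = Q E) ->
  forall A, measurable A -> P A = Q A.
Proof.
move=> h; apply: (@measure_unique _ _ _ (@finite_sets I) (fun=> setT)).
- exact: measurable_binseqE.
- by move=> A B [s hs] [s' hs']; exists (s ++ s'); exact: findepI.
- by move=> _; exists [::].
- by rewrite bigcup_const//; exists 0%N.
- by move=> A [s /h].
- by move=> k /=; rewrite probability_setT ltry.
Qed.

End measures_on_sequences.

Definition symdiff (T : Type) (A B : set T) := (A `\` B) `|` (B `\` A).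

(** * Approximation by finitely dependent sets *)

Section approximation.
Context (I : countType) (R : realType) (P : probability (binseq I) R).
Implicit Types (A B C : set (binseq I)).

Lemma measurable_symdiff A B : measurable A -> measurable B ->
  measurable (symdiff A B).
Proof. by move=> mA mB; apply: measurableU; apply: measurableD. Qed.

Let approximable A := measurable A /\ forall e : R, 0 < e ->
  exists2 E, exists s, findep s E & pr P (symdiff A E) <= e.

Let pr_symdiff_trans A B C : measurable A -> measurable B -> measurable C ->
  pr P (symdiff A C) <= pr P (symdiff A B) + pr P (symdiff B C).
Proof.
move=> mA mB mC; rewrite (le_trans _ (prU_le _ _ _))//; last 2 first.
- exact: measurable_symdiff.
- exact: measurable_symdiff.
apply: pr_le; first exact: measurable_symdiff.
  by apply: measurableU; exact: measurable_symdiff.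
move=> x; rewrite /symdiff /setU /setD /=.
by have [Bx|nBx] := pselect (B x); tauto.
Qed.

Let approximableU A B : approximable A -> approximable B ->
  approximable (A `|` B).
Proof.
move=> [mA hA] [mB hB]; split; first exact: measurableU.
move=> e e0; have e2 : 0 < e / 2 by rewrite divr_gt0.
have [E [s hs] EA] := hA _ e2; have [F [s' hs'] FB] := hB _ e2.
have hEF : findep (s ++ s') (E `|` F).
  rewrite -[_ `|` _]setCK setCU.
  exact: (findepC (findepI (findepC hs) (findepC hs'))).
exists (E `|` F); first by exists (s ++ s').
have mE := measurable_findep hs; have mF := measurable_findep hs'.
rewrite (le_trans _ (_ : pr P (symdiff A E) + pr P (symdiff B F) <= _))//.
  rewrite (le_trans _ (prU_le _ _ _))//; [|exact: measurable_symdiff..].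
  apply: pr_le.
  - by apply: measurable_symdiff; exact: measurableU.
  - by apply: measurableU; exact: measurable_symdiff.
  - by move=> x; rewrite /symdiff /setU /setD /=; tauto.
by rewrite [leRHS](splitr e) lerD.
Qed.

(** The approximable sets form a sigma-algebra. Complements keep the symmetric difference, and a
    countable union is first replaced by a finite one, by continuity from below. *)
Lemma findep_approx A (e : R) : measurable A -> 0 < e ->
  exists2 E, exists s, findep s E & pr P (symdiff A E) <= e.
Proof.
move=> mA e0; suff [_ /(_ e e0)] : approximable A by [].
move: A mA; rewrite measurable_binseqE; apply: smallest_sub; last first.
  move=> E [s hs]; split=> [|d d0]; first exact: measurable_findep hs.
  exists E; first by exists s.
  by rewrite /symdiff setDv setU0 pr0 ltW.
split.
- split=> [|d d0]; first exact: measurable0.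
  exists set0; first by exists [::].
  by rewrite /symdiff setDv setU0 pr0 ltW.
- move=> A [mA hA]; rewrite setTD; split=> [|d d0]; first exact: measurableC.
  have [E [s hs] h] := hA _ d0; exists (~` E); first by exists s; exact: findepC.
  rewrite (_ : symdiff _ _ = symdiff A E)//; apply/seteqP.
  by split=> x; rewrite /symdiff /setU /setD /setC /=;
    have [Ax|nAx] := pselect (A x); have [Ex|nEx] := pselect (E x); tauto.
move=> A hA; have mA i : measurable (A i) by case: (hA i).
have mU : measurable (\bigcup_i A i) by exact: bigcupT_measurable.
split=> // d d0; have d2 : 0 < d / 2 by rewrite divr_gt0.
pose B n := \big[setU/set0]_(i < n) A i.
have hB n : approximable (B n).
  elim: n => [|n IH]; rewrite /B ?big_ord0 ?big_ord_recr//=.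
    split=> [|d' d'0]; first exact: measurable0.
    exists set0; first by exists [::].
    by rewrite /symdiff setDv setU0 pr0 ltW.
  exact: approximableU.
have mB n : measurable (B n) by case: (hB n).
have BU n : B n `<=` \bigcup_i A i.
  by rewrite /B -bigcup_mkord => x [i _ Ax]; exists i.
have : P (B n) @[n --> \oo] --> P (\bigcup_i A i).
  rewrite (_ : \bigcup_i A i = \bigcup_n B n); last first.
    apply/seteqP; split=> x [i _].
      move=> Ax; exists i.+1 => //.
      by rewrite /B -bigcup_mkord; exists i => //=.
    by move=> /BU.
  apply: nondecreasing_cvg_mu => //; first exact: bigcupT_measurable.
  move=> m n mn; rewrite /B; apply/subsetPset.
  by rewrite -!bigcup_mkord; apply: bigcup_subset => i /= im; exact: leq_trans mn.
rewrite prE// => /fine_cvgP[_] /cvgrPdist_le/(_ _ d2)[n _ /(_ n (leqnn n)) /=].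
move=> hn; have [_ /(_ _ d2)[E [s hs] hE]] := hB n.
exists E; first by exists s.
have mE := measurable_findep hs.
rewrite (le_trans (pr_symdiff_trans mU (mB n) mE))//.
rewrite [leRHS](splitr d) lerD//.
apply: le_trans hn; rewrite (le_trans _ (ler_norm _))// /symdiff.
have -> : B n `\` \bigcup_i A i = set0.
  by apply/seteqP; split=> // x [/BU].
rewrite setU0 (pr_split P mU (mB n)) (setIidr (@BU n)) [X in _ <= X - _]addrC.
by rewrite -[fine (P (B n))]/(pr P (B n)) addrK setDE.
Qed.

End approximation.

(** * Measures from consistent cylinder masses *)

Lemma image_probability d d' (T : measurableType d) (T' : measurableType d')
    (R : realType) (P : probability T R) (f : T -> T') :
  measurable_fun setT f ->
  exists Q : probability T' R, forall A, Q A = P (f @^-1` A).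
Proof.
move=> mf; pose F : {mfun T >-> T'} := mfun_Sub (mem_set mf).
by exists (distribution P F).
Qed.

Lemma uniform_prob_itv (R : realType) (a b : R) : 0 <= a -> a <= b -> b <= 1 ->
  pr (uniform_prob (@ltr01 R)) `[a, b[%classic = b - a.
Proof.
move=> a0 ab b1; apply: EFin_inj; rewrite -prE//= /uniform_prob.
rewrite integral_uniform_pdf setIidl; last first.
  move=> x /=; rewrite !in_itv/= => /andP[ax xb].
  by rewrite (le_trans a0 ax) (le_trans (ltW xb)).
rewrite (eq_integral (fun=> 1%E)); last first.
  move=> x; rewrite inE/= in_itv/= => /andP[ax xb].
  rewrite /uniform_pdf (le_trans a0 ax) (le_trans (ltW xb))//.
  by rewrite subr0 invr1.
rewrite integral_cst//= mul1e lebesgue_measure_itv/= lte_fin.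
case: ltgtP ab => // <- _.
by rewrite subrr.
Qed.

Section tree_measure.
Context (R : realType) (F : seq bool -> R).
Hypothesis F0 : forall u, 0 <= F u.
Hypothesis F1 : F [::] = 1.
Hypothesis FD : forall u, F u = F (rcons u false) + F (rcons u true).

(** The left endpoint of the interval of [u]: the total mass of the words of the same length that
    precede [u] lexicographically, since every 1 in [u] skips the sibling ending in 0. *)
Let lo (u : seq bool) : R :=
  \sum_(i < size u | nth false u i) F (rcons (take i u) false).

Let lo_rcons u b : lo (rcons u b) = lo u + (if b then F (rcons u false) else 0).
Proof.
rewrite /lo size_rcons big_mkcond big_ord_recr/= nth_rcons ltnn eqxx.
rewrite [in RHS]big_mkcond/= -cats1 take_size_cat//; congr (_ + _).
apply: eq_bigr => i _; rewrite nth_cat ltn_ord takel_cat//; exact: ltnW.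
Qed.

Let in_interval u : 0 <= lo u /\ lo u + F u <= 1.
Proof.
elim/last_ind: u => [|u b [IH1 IH2]]; first by rewrite /lo big_ord0 add0r F1.
rewrite lo_rcons; have := FD u; have := F0 (rcons u false).
by have := F0 (rcons u true); case: b; split; lra.
Qed.

(* The nested intervals [lo u, lo u + F u[ code the words [u] by their
   prefixes, each interval being split according to [FD]. *)
Fixpoint prefix_of n (x : R) : seq bool :=
  if n is m.+1 then let p := prefix_of m x in
    rcons p (lo p + F (rcons p false) <= x)
  else [::].

Let size_prefix n x : size (prefix_of n x) = n.
Proof. by elim: n => //= n IH; rewrite size_rcons IH. Qed.

Let prefixP n x u : 0 <= x < 1 -> size u = n ->
  (prefix_of n x = u) <-> (lo u <= x < lo u + F u).
Proof.
move=> x01 <-; elim/last_ind: u => [|u b IH] {n}.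
  by rewrite /= /lo big_ord0 add0r F1; split.
rewrite size_rcons /= lo_rcons; have := FD u; have := F0 (rcons u false).
have := F0 (rcons u true) => f1 f0 fE; split=> [/rcons_inj[pu]|h].
  rewrite pu => <-; move/IH: pu => /andP[h1 h2].
  by apply/andP; case: (lerP (lo u + F (rcons u false)) x) => ?; split; lra.
case/andP: h => h1 h2.
have /IH -> : lo u <= x < lo u + F u.
  by apply/andP; split; move: h1 h2; case: b; lra.
by congr rcons; case: (lerP (lo u + F (rcons u false)) x) => ?; case: b h1 h2 => //; lra.
Qed.

Let measurable_prefix n u : measurable [set x | prefix_of n x = u].
Proof.
elim: n u => [|n IH] u /=.
  have [->|/eqP nu] := eqVneq u [::].
    by rewrite (_ : mkset _ = setT)//; apply/seteqP.
  rewrite (_ : mkset _ = set0)//; apply/seteqP; split => // x /= /esym.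
  by move/nu.
case/lastP: u => [|u b].
  rewrite (_ : mkset _ = set0)//; apply/seteqP; split => // x /=.
  by move/(congr1 size); rewrite size_rcons.
rewrite (_ : mkset _ = [set x | prefix_of n x = u]
    `&` [set x | (lo u + F (rcons u false) <= x) = b]).
  apply: measurableI; first exact: IH.
  have mI : measurable [set x | lo u + F (rcons u false) <= x].
    rewrite (_ : mkset _ = `[lo u + F (rcons u false), +oo[%classic)//.
    by apply/seteqP; split=> x; rewrite /= in_itv/= andbT.
  case: b; first by rewrite (_ : mkset _ = [set x | lo u + F (rcons u false) <= x]).
  rewrite (_ : mkset _ = ~` [set x | lo u + F (rcons u false) <= x]).
    exact: measurableC.
  by apply/seteqP; split=> x /=; [move=> ->|move/negP/negbTE].
apply/seteqP; split=> x /= => [/rcons_inj[<- <-]//|[-> ->]//].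
Qed.

Let code (x : R) : binseq nat := fun j => nth false (prefix_of j.+1 x) j.

Let code_prefix n x j : (j < n)%N -> code x j = nth false (prefix_of n x) j.
Proof.
elim: n => // n IH; rewrite ltnS leq_eqVlt => /predU1P[->//|jn].
by rewrite /= nth_rcons size_prefix jn IH.
Qed.

(** The image of the uniform measure on the unit interval under the map sending a point to the
    sequence coded by the nested intervals that contain it. *)
Lemma tree_measure : exists P : probability (binseq nat) R, forall u,
  pr P [set t : binseq nat | forall j, (j < size u)%N -> t j = nth false u j] = F u.
Proof.
have mcode : measurable_fun setT code.
  apply: measurable_to_binseq => j.
  rewrite (_ : mkset _ = \big[setU/set0]_(u : j.+1.-tuple bool | nth false u j)
      [set x | prefix_of j.+1 x = u]).
    by apply: bigsetU_measurable.
  rewrite -bigcup_seq_cond; apply/seteqP; split=> x /=.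
    move=> cx; exists (tcast (size_prefix j.+1 x) (in_tuple (prefix_of j.+1 x))).
      by rewrite /= mem_index_enum val_tcast.
    by rewrite /= val_tcast.
  by case=> u /= /andP[_ nu] xu; rewrite /code /= in xu *; rewrite xu.
have [P PE] := image_probability (uniform_prob (@ltr01 R)) mcode.
exists P => u.
have [l0 l1] := in_interval u; have Fu0 := F0 u.
pose U := [the probability _ R of uniform_prob (@ltr01 R)].
set E : set (binseq nat) := [set t | _]; pose S := code @^-1` E.
have -> : pr P E = pr U S by rewrite /pr PE.
have mE : measurable E.
  apply: (@measurable_findep _ (iota 0 (size u))) => t t' tt' h j ju.
  by rewrite -tt' ?mem_iota// h.
have mS : measurable S by rewrite -[S]setTI; exact: mcode.
(* The intervals describe the coding only on [[0, 1[]; the rest of the line is also coded, but has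
   mass 0. *)
pose J : set R := `[0, 1[%classic.
have mI : measurable J by exact: measurable_itv.
rewrite (pr_split U mS mI).
have -> : S `&` J = `[lo u, lo u + F u[%classic.
  apply/seteqP; split=> x.
    case=> Sx; rewrite /J /= !in_itv/= => x01; apply/(prefixP x01 erefl).
    apply: (@eq_from_nth _ false); rewrite ?size_prefix// => j ju.
    by rewrite -code_prefix// Sx.
  rewrite /= in_itv/= => h.
  have x01 : 0 <= x < 1.
    by move/andP: h => [h1 h2]; apply/andP; split; lra.
  split; last by rewrite /J /= in_itv.
  by move=> j ju; rewrite (@code_prefix (size u))// (prefixP x01 erefl).2.
rewrite uniform_prob_itv ?lerDl//.
suff -> : pr U (S `&` ~` J) = 0 by rewrite addr0 addrAC subrr add0r.
apply/eqP; rewrite eq_le pr_ge0 andbT.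
rewrite (@le_trans _ _ (pr U (~` J)))//.
  apply: pr_le; [|exact: measurableC|by move=> x []].
  by apply: measurableI => //; exact: measurableC.
by rewrite prC// /J uniform_prob_itv// subr0 subrr.
Qed.

End tree_measure.

(** * The block shift *)

Lemma measurable_pattern d (T : measurableType d) n (B : 'I_n -> set T) u :
  (forall i, measurable (B i)) ->
  measurable [set x | [ffun i => `[< B i x >]] = u].
Proof.
move=> mB.
have -> : [set x | [ffun i => `[< B i x >]] = u] =
    \bigcap_(i in [set: 'I_n]) [set x | `[< B i x >] = u i].
  apply/seteqP; split=> x /= => [<- i _|h']; first by rewrite /= ffunE.
  by apply/ffunP => i; rewrite ffunE; exact: h'.
apply: fin_bigcap_measurable => [|i _]; first exact: finite_finset.
case: (u i).
  by rewrite (_ : mkset _ = B i)//; apply/seteqP; split=> x /asboolP.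
rewrite (_ : mkset _ = ~` B i); first exact: measurableC.
by apply/seteqP; split=> x /= => [/negbT/asboolPn|/asboolPn/negbTE].
Qed.

Section counting_events.
Context d (T : measurableType d) (R : realType) (P : probability T R).

(** A bound on an expected number of events. On each piece of [A] where the pattern of occurring
    events is fixed, their number is a constant between [lo] and [hi]; the finitely many pieces are
    then summed. *)
Lemma pr_count_bounds n (A : set T) (B : 'I_n -> set T) (lo hi : R) :
  measurable A -> (forall i, measurable (B i)) ->
  (forall x, A x -> lo <= \sum_(i < n) (`[< B i x >] : nat)%:R <= hi) ->
  lo * pr P A <= \sum_(i < n) pr P (A `&` B i) <= hi * pr P A.
Proof.
move=> mA mB h.
pose f x : {ffun 'I_n -> bool} := [ffun i => `[< B i x >]].
have mf u : measurable [set x | f x = u] by exact: measurable_pattern.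
have e i : pr P (A `&` B i) = \sum_(u : {ffun 'I_n -> bool})
    (u i : nat)%:R * pr P (A `&` [set x | f x = u]).
  rewrite (@pr_sum_fiber _ _ _ _ _ f) //; last exact: measurableI.
  apply: eq_bigr => u _; case ui : (u i).
    rewrite mul1r; congr pr; rewrite -setIA; congr (_ `&` _).
    rewrite setIidr// => x /= fx; apply/asboolP; have := ui.
    by rewrite -fx ffunE.
  rewrite mul0r (_ : _ `&` _ = set0) ?pr0//; apply/seteqP; split=> // x [[_ Bx]] /= fx.
  by move: ui; rewrite -fx ffunE => /asboolPn.
have mAf u : measurable (A `&` [set x | f x = u]) by exact: measurableI.
under eq_bigr do rewrite e; rewrite exchange_big/=.
rewrite [in X in _ * X <= _](@pr_sum_fiber _ _ _ P _ f) //.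
rewrite [in X in _ <= _ * X](@pr_sum_fiber _ _ _ P _ f) //.
rewrite !mulr_sumr; apply/andP.
suff H u : lo * pr P (A `&` [set x | f x = u])
    <= \sum_(i < n) (u i : nat)%:R * pr P (A `&` [set x | f x = u])
    <= hi * pr P (A `&` [set x | f x = u]).
  by split; apply: ler_sum => u _; case/andP: (H u).
have [->|/set0P[x [Ax /= fx]]] := eqVneq (A `&` [set x | f x = u]) set0.
  by rewrite pr0 !mulr0 big1 ?lexx// => i _; rewrite mulr0.
rewrite -mulr_suml; have /andP[h1 h2] := h x Ax.
have -> : \sum_(i < n) (u i : nat)%:R = \sum_(i < n) (`[< B i x >] : nat)%:R :> R.
  by apply: eq_bigr => i _; rewrite -fx ffunE.
by apply/andP; split; apply: ler_wpM2r; rewrite ?pr_ge0.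
Qed.

End counting_events.

Lemma iter_left_shift n (t : Sigma) i : iter n left_shift t i = t (i + n%:Z).
Proof.
elim: n i => [|n IH] i; first by rewrite addr0.
by rewrite iterS /left_shift IH; congr t; lia.
Qed.

Definition trace (t : Sigma) (a : int) : nat -> bool := fun i => t (a + i%:Z).

Lemma window_iter_shift (t : Sigma) n a p l :
  window (trace (iter n left_shift t) a) p l = window (trace t a) (n + p)%N l.
Proof.
apply: eq_window => i _; rewrite /trace iter_left_shift; congr t; lia.
Qed.

Lemma continuous_left_shift : continuous left_shift.
Proof.
move=> t; apply/cvg_sup => k U [_ [[B oB <-] /= Bk]] /filterS; apply.
apply: (@proj_continuous _ (fun _ : int => bool) (k + 1) t B).
by apply: open_nbhs_nbhs; split.
Qed.

Lemma measurable_left_shift : measurable_fun setT left_shift.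
Proof. exact: continuous_measurable_binseq continuous_left_shift. Qed.

Lemma findep_shift s (E : set Sigma) n : findep s E ->
  findep [seq i + n%:Z | i <- s] (iter n left_shift @^-1` E).
Proof.
move=> h t t' tt'; apply: h => i si; rewrite !iter_left_shift.
by apply: tt'; apply/mapP; exists i.
Qed.

(** Each level and each finite stretch may be parsed with its own offset. The conditions are thus
    separate finitely dependent ones, and their intersection is closed. *)
Definition block_shift : set Sigma :=
  [set t | forall k n a, parsed k n (trace t a)].

Lemma findep_parsed k n a :
  findep [seq a + i%:Z | i <- iota 0 n] [set t | parsed k n (trace t a)].
Proof.
move=> t t' tt'; apply: eq_parsed => i iln; apply: tt'.
by apply/mapP; exists i => //; rewrite mem_iota.
Qed.

Lemma block_shiftE : block_shift =
  \bigcap_(q in [set: nat * nat * int]) [set t | parsed q.1.1 q.1.2 (trace t q.2)].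
Proof.
apply/seteqP; split=> t; first by move=> h [[k n] a] _; exact: h.
by move=> h k n a; exact: (h (k, n, a)).
Qed.

Lemma closed_block_shift : closed block_shift.
Proof.
rewrite block_shiftE; apply: closed_bigI => q _.
exact: (@closed_findep int _ _ (@findep_parsed q.1.1 q.1.2 q.2)).
Qed.

Lemma compact_binseq (I : eqType) : compact [set: binseq I].
Proof.
have := @tychonoff I (fun=> bool) (fun=> setT) (fun=> bool_compact).
by congr compact; apply/seteqP.
Qed.

Lemma compact_block_shift : compact block_shift.
Proof.
apply: (@subclosed_compact _ _ setT) => //; first exact: closed_block_shift.
exact: compact_binseq.
Qed.

Lemma measurable_block_shift : measurable block_shift.
Proof.
rewrite -[block_shift]setCK; apply: measurableC; apply: measurable_open.
exact/closed_openC/closed_block_shift.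
Qed.

Lemma block_shift_shift t : block_shift t -> block_shift (left_shift t).
Proof.
move=> h k n a; apply: eq_parsed (h k n (a + 1)) => i _.
by rewrite /trace /left_shift; congr t; lia.
Qed.

Lemma block_shift_iter n t : block_shift t -> block_shift (iter n left_shift t).
Proof. by elim: n => // n IH /IH; exact: block_shift_shift. Qed.

Lemma image_block_shift : left_shift @` block_shift = block_shift.
Proof.
apply/seteqP; split=> [_ [t tX <-]|t tX]; first exact: block_shift_shift.
exists (fun i => t (i - 1)).
  move=> k n a; apply: eq_parsed (tX k n (a - 1)) => i _.
  by rewrite /trace; congr t; lia.
by apply/funext => i; rewrite /left_shift addrK.
Qed.

Definition periodic_point k : Sigma :=
  fun i => nth false (head [::] (blocks k)) (absz (i %% (blen k)%:Z)%Z).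

Lemma parsed_periodic_point j k n a : (j <= k)%N ->
  parsed j n (trace (periodic_point k) a).
Proof.
move=> jk; have wk : head [::] (blocks k) \in blocks k.
  by have := size_blocks_ge16 k; case: (blocks k) => //= *; rewrite mem_head.
apply: eq_parsed (@periodic_parsed _ _ (absz (a %% (blen k)%:Z)%Z) _ n wk jk) => i _.
rewrite /trace /periodic_point; congr nth.
have l0 := blen_gt0 k.
have : (absz (a %% (blen k)%:Z)%Z)%:Z = (a %% (blen k)%:Z)%Z.
  by rewrite gez0_abs// modz_ge0//; lia.
move: (absz (a %% (blen k)%:Z)%Z) => b bE.
have <- : ((b + i)%N%:Z %% (blen k)%:Z)%Z = ((a + i%:Z) %% (blen k)%:Z)%Z.
  by rewrite PoszD bE modzDml.
by rewrite modz_nat.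
Qed.

(** A cluster point of the periodic points: each condition of level [k] is clopen and holds for all
    periodic points of level at least [k]. *)
Lemma block_shift_nonempty : block_shift !=set0.
Proof.
have [] := @compact_binseq int (periodic_point @ \oo) _ filterT.
move=> p [_ clp]; exists p => k n a; apply: contrapT => np.
have [] := clp [set t | parsed k n (trace t a)] (~` [set t | parsed k n (trace t a)]).
- by exists k => // m /= km; exact: parsed_periodic_point.
- apply: open_nbhs_nbhs; split=> //.
  exact: (@open_findep int _ _ (findepC (@findep_parsed k n a))).
by move=> t [].
Qed.

(** Every block of level 1 contains the block [11111]. This later excludes the default value in
    [disintegration]. *)
Lemma zero_notin_block_shift : ~ block_shift (fun=> false).
Proof.
move=> /(_ 1%N (2 * blen 1)%N 0) [r rL h'].
have h0 : (r + 1 * blen 1 <= 2 * blen 1)%N by lia.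
have /window_block_split[ss pss h] := h' 0%N h0.
have w5 : nseq 5 true \in blocks 0.
  by apply/mapP; exists [tuple of nseq 5 true]; rewrite ?mem_enum.
have iss : (index (nseq 5 true) ss < size (blocks 0))%N.
  by rewrite -(perm_size pss) index_mem (perm_mem pss).
by have := h _ iss; rewrite nth_index ?(perm_mem pss).
Qed.

(** * Uniform frequencies *)

Definition hits (E : set Sigma) (t : Sigma) (n : nat) : nat :=
  \sum_(i < n) `[< E (iter i left_shift t) >].

Lemma hits_cat E t n m :
  hits E t (n + m) = (hits E t n + hits E (iter n left_shift t) m)%N.
Proof.
rewrite /hits big_split_ord; congr addn; apply: eq_bigr => i _.
by rewrite -iterD [in RHS]addnC.
Qed.

Lemma findep_window s (E : set Sigma) : findep s E -> exists (a : int) m phi,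
  forall t n, hits E t n = visits phi (trace t a) m 0 n.
Proof.
move=> h; pose N := (\max_(i <- s) absz i).+1.
exists (- N%:Z), (2 * N)%N.
exists (fun v => `[< E (fun i => nth false v (absz (i + N%:Z))) >]) => t n.
apply: eq_bigr => p _; congr nat_of_bool; apply: asbool_equiv_eq.
have e : {in s, iter p left_shift t =1 fun i : int =>
    nth false (window (trace t (- N%:Z)) (0 + p) (2 * N)) (absz (i + N%:Z))}.
  move=> i si; have : (absz i <= \max_(i <- s) absz i)%N.
    by apply: (@leq_bigmax_seq _ _ xpredT).
  rewrite -ltnS -/N => iN; rewrite nth_window; last by lia.
  by rewrite iter_left_shift /trace; congr t; lia.
by split; apply: h => // i si; rewrite e.
Qed.

Section uniform_frequencies.
Context (R : realType).
Implicit Types (E : set Sigma) (v x e : R).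

Definition near_freq E v e (M : nat) := (0 < M)%N /\
  forall t, block_shift t -> `|(hits E t M)%:R - v * M%:R| <= e * M%:R.

Lemma near_freq_mul E v e M n : near_freq E v e M -> (0 < n)%N ->
  near_freq E v e (n * M).
Proof.
move=> [M0 h] n0; split; first by rewrite muln_gt0 n0.
elim: {n0} n => [t _|n IH t tX].
  by rewrite mul0n /hits big_ord0 !mulr0 subrr normr0.
rewrite mulSn hits_cat !natrD !mulrDr.
have := h t tX; have := IH _ (block_shift_iter M tX).
by rewrite !ler_norml => /andP[h1 h2] /andP[h3 h4]; apply/andP; split; lra.
Qed.

(** Both approximations apply to one orbit over the common time [M' * M]. *)
Lemma near_freq_dist E v v' e e' M M' :
  near_freq E v e M -> near_freq E v' e' M' -> v <= v' + (e + e').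
Proof.
move=> h h'; have [M0 _] := h; have [M'0 _] := h'.
have [K0 k] := near_freq_mul h M'0.
have [_] := near_freq_mul h' M0; rewrite mulnC.
have [t tX] := block_shift_nonempty.
move=> /(_ t tX) + ; have := k t tX.
have K0' : (0 : R) < (M' * M)%:R by rewrite ltr0n.
rewrite !ler_norml => /andP[h1 h2] /andP[h3 h4].
by rewrite -(ler_pM2r K0') !mulrDl; lra.
Qed.

Lemma near_freq_ex s E e : findep s E -> 0 < e ->
  exists v M, near_freq E v e M.
Proof.
move=> /findep_window[a [m [phi hE]]] e0.
have ex_nat (x : R) : exists2 n : nat, (0 < n)%N & x / e <= n%:R.
  by exists (Num.truncn (x / e)).+1 => //; exact/ltW/truncnS_gt.
(* The error of [visits_uniform], relative to [n * L], consists of [1 / n] from the ends and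
   [m / blen k] from the windows across block boundaries; each is made at most [e / 2]. *)
have [k k0 hk] := ex_nat (2 * m%:R); have [n n0 hn] := ex_nat 2.
have [c cL h] := visits_uniform phi m k.
have LE : blen k.+1 = (size (blocks k) * blen k)%N by [].
have L0 := blen_gt0 k.+1.
move: (blen k.+1) (size (blocks k)) LE L0 cL h => L N LE L0 cL h.
exists (c%:R / L%:R), (n * L)%N; split; first by rewrite muln_gt0 n0.
move=> t tX; have [] := h (trace t a) n (n.+1 * L)%N (leqnn _) (tX _ _ _).
rewrite -hE -(ler_nat R) !natrD !natrM => h1.
rewrite -(ler_nat R) !natrD !natrM => h2.
have -> : c%:R / L%:R * (n%:R * L%:R) = n%:R * c%:R :> R.
  by field; rewrite pnatr_eq0 -lt0n.
have n2 : 2 <= e * n%:R by rewrite mulrC -ler_pdivrMr.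
have Lk : 2 * m%:R <= e * (blen k)%:R.
  rewrite [e * _]mulrC -ler_pdivrMr// (le_trans hk)// ler_nat ltnW//.
  exact: blen_gt.
have hL : 2 * L%:R <= e * (n%:R * L%:R) by rewrite mulrA ler_wpM2r.
have hm : 2 * (n%:R * (N%:R * m%:R)) <= e * (n%:R * L%:R).
  rewrite LE natrM.
  have : 0 <= n%:R * N%:R :> R by rewrite mulr_ge0.
  move=> /ler_wpM2l/(_ _ _ Lk); lra.
by rewrite ler_norml; apply/andP; split; lra.
Qed.

(** Each [v] that is a frequency up to [e] certifies the lower bound [v - e]; by [near_freq_dist]
    the supremum of these bounds is within [e] of every such [v]. *)
Definition mean E : R := sup [set x | exists e M, 0 < e /\ near_freq E (x + e) e M].

Lemma near_mean s E e : findep s E -> 0 < e -> exists M, near_freq E (mean E) e M.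
Proof.
move=> hE e0; have e2 : 0 < e / 2 by rewrite divr_gt0.
have [v [M h]] := near_freq_ex hE e2; exists M.
pose S := [set x | exists e M, 0 < e /\ near_freq E (x + e) e M].
have Sv : S (v - e / 2) by exists (e / 2), M; rewrite subrK.
have ubS : ubound S (v + e / 2).
  move=> x [e' [M' [e'0 h']]]; have := near_freq_dist h' h; lra.
have hS : has_sup S by split; [exists (v - e / 2)|exists (v + e / 2)].
have lo : v - e / 2 <= mean E by exact: ub_le_sup hS.2 _ Sv.
have hi : mean E <= v + e / 2 by apply: ge_sup => //; exists (v - e / 2).
have [M0 k] := h; split=> // t tX; have := k t tX.
have : 0 <= M%:R :> R by [].
rewrite !ler_norml => hM /andP[h1 h2]; apply/andP; split; nra.
Qed.

Lemma mean_unique s E v : findep s E ->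
  (forall e, 0 < e -> exists M, near_freq E v e M) -> mean E = v.
Proof.
move=> hE hv; apply/eqP; rewrite eq_le; apply/andP; split;
  apply/ler_addgt0Pr => e e0; have e2 : 0 < e / 2 by rewrite divr_gt0.
- have [M h] := near_mean hE e2; have [M' h'] := hv _ e2.
  by have := near_freq_dist h h'; lra.
- have [M h] := near_mean hE e2; have [M' h'] := hv _ e2.
  by have := near_freq_dist h' h; lra.
Qed.

Lemma mean_ge0 s E : findep s E -> 0 <= mean E.
Proof.
move=> hE; apply/ler_addgt0Pr => e e0.
have [M [M0 h]] := near_mean hE e0.
have [t tX] := block_shift_nonempty; have := h t tX.
have : 0 <= (hits E t M)%:R :> R by [].
have M0' : (0 : R) < M%:R by rewrite ltr0n.
rewrite ler_norml => ? /andP[? ?]; rewrite -(ler_pM2r M0') mul0r mulrDl; lra.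
Qed.

Lemma hits_block_shift E t n : block_shift `<=` E -> block_shift t ->
  hits E t n = n.
Proof.
move=> XE tX; rewrite /hits (eq_bigr (fun=> 1%N)).
  by rewrite sum_nat_const card_ord muln1.
move=> i _; rewrite (_ : `[< _ >] = true)//; apply/asboolP/XE.
exact: block_shift_iter.
Qed.

Lemma mean_block_shift s E : findep s E -> block_shift `<=` E -> mean E = 1.
Proof.
move=> hE XE; apply: (mean_unique hE) => e e0; exists 1%N; split=> // t tX.
by rewrite hits_block_shift// mul1r subrr normr0 mulr1 ltW.
Qed.

Lemma mean_shift s E : findep s E -> mean (left_shift @^-1` E) = mean E.
Proof.
move=> hE.
apply: (@mean_unique _ (left_shift @^-1` E) _ (findep_shift (n:=1) hE)) => e e0.
have [M [M0 h]] := near_mean hE e0; exists M; split=> // t tX.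
have -> : hits (left_shift @^-1` E) t M = hits E (left_shift t) M.
  by apply: eq_bigr => i _; rewrite -iterSr.
by apply: h; exact: block_shift_shift.
Qed.

Lemma meanU s1 s2 E1 E2 : findep s1 E1 -> findep s2 E2 -> E1 `&` E2 = set0 ->
  mean (E1 `|` E2) = mean E1 + mean E2.
Proof.
move=> h1 h2 E12.
have hU : findep (s1 ++ s2) (E1 `|` E2).
  rewrite -[_ `|` _]setCK setCU.
  exact: (findepC (findepI (findepC h1) (findepC h2))).
apply: (mean_unique hU) => e e0; have e2 : 0 < e / 2 by rewrite divr_gt0.
have [M1 k1] := near_mean h1 e2; have [M2 k2] := near_mean h2 e2.
have [K0 l1] := near_freq_mul k1 k2.1; have [_ l2] := near_freq_mul k2 k1.1.
exists (M2 * M1)%N; split=> // t tX; have := l1 t tX; have := l2 t tX.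
have -> : hits (E1 `|` E2) t (M2 * M1) =
    (hits E1 t (M2 * M1) + hits E2 t (M2 * M1))%N.
  rewrite /hits -big_split; apply: eq_bigr => i _ /=.
  set x := iter _ _ _; have [x1|x1] := pselect (E1 x); have [x2|x2] := pselect (E2 x).
  - by have : (E1 `&` E2) x by []; rewrite E12.
  - by rewrite (asboolT x1) (asboolF x2) asboolT//; left.
  - by rewrite (asboolF x1) (asboolT x2) asboolT//; right.
  - by rewrite (asboolF x1) (asboolF x2) asboolF// => -[].
rewrite natrD mulrDl [(M1 * M2)%N]mulnC !ler_norml => /andP[? ?] /andP[? ?].
by apply/andP; split; lra.
Qed.

End uniform_frequencies.

(** * The frequency measure *)

Lemma preimage_iter_shiftS n (E : set Sigma) :
  iter n.+1 left_shift @^-1` E = left_shift @^-1` (iter n left_shift @^-1` E).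
Proof. by apply/funext => x; rewrite /preimage /mkset iterSr. Qed.

Section frequency_measure.
Context (R : realType).

(** A zigzag enumeration of the integers, by which one-sided words index cylinders of two-sided
    sequences. *)
Let coord (j : nat) : int := if odd j then Negz j./2 else Posz j./2.
Let rank (i : int) : nat := match i with Posz k => k.*2 | Negz k => k.*2.+1 end.

Let coordK : cancel rank coord.
Proof.
by case=> k; rewrite /coord /= odd_double /= ?doubleK// uphalf_double.
Qed.

Let rankK : cancel coord rank.
Proof.
move=> j; rewrite /coord /rank; have := odd_double_half j.
by case: odd => /=; lia.
Qed.

Let C (u : seq bool) : set Sigma :=
  [set t | forall j, (j < size u)%N -> t (coord j) = nth false u j].

Let findepC0 u : findep [seq coord j | j <- iota 0 (size u)] (C u).
Proof.
move=> t t' tt' h j ju; rewrite -tt' ?h//.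
by apply/mapP; exists j => //; rewrite mem_iota.
Qed.

Let C_rcons u : C u = C (rcons u false) `|` C (rcons u true) /\
  C (rcons u false) `&` C (rcons u true) = set0.
Proof.
have h b t : C (rcons u b) t <-> C u t /\ t (coord (size u)) = b.
  split=> [h|[h hb] j].
    split=> [j ju|]; last by rewrite h ?size_rcons// nth_rcons ltnn eqxx.
    by rewrite h ?size_rcons ?ltnS 1?ltnW// nth_rcons ju.
  rewrite size_rcons ltnS leq_eqVlt nth_rcons => /predU1P[->|ju].
    by rewrite ltnn eqxx.
  by rewrite ju h.
split; apply/seteqP; split=> t //.
- by move=> Ct; case e : (t (coord (size u))); [right|left]; apply/h.
- by case=> /h[].
- by case=> /h[_ e1] /h[_]; rewrite e1.
Qed.

Lemma mean_split s (E : set Sigma) u : findep s E ->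
  mean R (E `&` C u) =
  mean R (E `&` C (rcons u false)) + mean R (E `&` C (rcons u true)).
Proof.
move=> hE; have [e1 e2] := C_rcons u.
rewrite -(meanU _ (findepI hE (@findepC0 _)) (findepI hE (@findepC0 _))).
  by rewrite -setIUr -e1.
by rewrite setIACA e2 setI0.
Qed.

(** The frequencies of the cylinders [C u] are additive weights on the tree of words, so they come
    from a measure. A finitely dependent set is a finite union of deep enough cylinders, and both
    sides are additive. *)
Lemma frequency_measure_ex : exists mu : probability Sigma R,
  forall s E, findep s E -> pr mu E = mean R E.
Proof.
have hT : @findep int [::] setT by [].
have [P hP] : exists P : probability (binseq nat) R, forall u,
    pr P [set t : binseq nat | forall j, (j < size u)%N -> t j = nth false u j]
    = mean R (C u).
  apply: tree_measure => [u||u].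
  - exact: mean_ge0 (@findepC0 u).
  - by apply: (mean_block_shift _ (@findepC0 [::])) => t _ j.
  - by have := mean_split u hT; rewrite !setTI.
pose psi (y : binseq nat) : Sigma := fun i => y (rank i).
have mpsi : measurable_fun setT psi.
  apply: measurable_to_binseq => i.
  by apply: (@measurable_findep _ [:: rank i]) => t t' tt'; rewrite /= /psi tt' ?inE.
have [mu muE] := image_probability P mpsi.
exists mu => s E hE.
have prmu A : pr mu A = pr P (psi @^-1` A) by rewrite /pr muE.
pose n := (\max_(i <- s) rank i).+1.
have mC A u : findep s A -> measurable (A `&` C u).
  by move=> hA; exact: measurable_findep (findepI hA (@findepC0 u)).
have prC u : pr mu (C u) = mean R (C u).
  rewrite prmu -hP; congr pr; apply/seteqP; split=> y /= h j ju.
    by have := h j ju; rewrite /psi rankK.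
  by rewrite /psi rankK h.
(* Induction on the distance [d] to the depth [n], at which [C u] fixes all coordinates in [s] and
   is either contained in [E] or disjoint from it. *)
have key d u : (size u + d = n)%N -> pr mu (E `&` C u) = mean R (E `&` C u).
  elim: d u => [|d IH] u; last first.
    rewrite addnS => un; rewrite (mean_split u hE) -!IH ?size_rcons ?addSn//.
    have [e1 e2] := C_rcons u; rewrite [in LHS]e1 setIUr prU//.
    - exact: mC.
    - exact: mC.
    - by rewrite setIACA e2 setI0.
  rewrite addn0 => un.
  have [->|/set0P[t [Et Ct]]] := eqVneq (E `&` C u) set0.
    rewrite pr0; have := mean_split [::] (hT); have h0 : @findep int [::] set0 by [].
    have := meanU R h0 h0 (set0I _); rewrite setU0 => h; lra.
  suff -> : E `&` C u = C u by [].
  apply/setIidr => t' Ct'; apply: hE Et => i si.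
  have iu : (rank i < size u)%N.
    by rewrite un ltnS; exact: (@leq_bigmax_seq _ _ xpredT).
  by rewrite -[i]coordK Ct// Ct'.
have := key n [::] (add0n _); rewrite (_ : C [::] = setT) ?setIT//.
by apply/seteqP; split.
Qed.

Lemma pr_countable_bigcap d (T : measurableType d) (P : probability T R)
    (J : countType) (F : J -> set T) :
  (forall j, measurable (F j)) -> (forall j, pr P (F j) = 1) ->
  pr P (\bigcap_j F j) = 1.
Proof.
move=> mF F1.
pose G n := if unpickle n is Some j then ~` F j else set0.
have mG n : measurable (G n).
  by rewrite /G; case: unpickle => // j; exact: measurableC.
have mU : measurable (\bigcup_n G n) by exact: bigcupT_measurable.
have -> : \bigcap_j F j = ~` \bigcup_n G n.
  apply/seteqP; split=> x h.
    by case=> n _; rewrite /G; case: unpickle => // j; apply; exact: h.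
  move=> j _; apply: contrapT => nF; apply: h; exists (pickle j) => //.
  by rewrite /G pickleK.
rewrite prC// (_ : pr P _ = 0) ?subr0//.
apply/eqP; rewrite eq_le pr_ge0 andbT -lee_fin -prE//.
apply: (le_trans (generalized_Boole_inequality _ _ _)) => //.
have PG n : P (G n) = 0%E.
  by rewrite prE// /G; case: unpickle => [j|]; rewrite ?prC ?pr0// F1 subrr.
by rewrite eseries0// => n _ _; exact: PG.
Qed.

(** Uniform frequencies make an invariant set independent of every finitely dependent set.
    Approximating the invariant set by such sets makes it independent of itself, so its mass is 0 or
    1. *)
Lemma ergodic_block_shift_ex : exists mu : probability Sigma R,
  [/\ pr mu block_shift = 1,
      forall A, measurable A -> mu (left_shift @^-1` A) = mu A
    & forall A, measurable A -> left_shift @^-1` A = A ->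
        pr mu A = 0 \/ pr mu A = 1].
Proof.
have [mu muE] := frequency_measure_ex; exists mu.
have mX := measurable_block_shift.
have prX : pr mu block_shift = 1.
  rewrite block_shiftE; apply: pr_countable_bigcap => -[[k n] a].
    exact: measurable_findep (@findep_parsed k n a).
  rewrite (muE _ _ (@findep_parsed k n a)).
  by apply: (mean_block_shift _ (@findep_parsed k n a)) => t; exact.
have inv A : measurable A -> mu (left_shift @^-1` A) = mu A.
  have [nu nuE] := image_probability mu measurable_left_shift.
  move=> mA; rewrite -nuE; apply: eq_probability_findep => // s E hE.
  have mE := measurable_findep hE.
  have mE' : measurable (left_shift @^-1` E).
    exact: measurable_findep (findep_shift (n:=1) hE).
  rewrite nuE !prE//; congr EFin.
  by rewrite (muE _ _ (findep_shift (n:=1) hE)) (muE _ _ hE) -(mean_shift _ hE).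
have prinv A : measurable A -> pr mu (left_shift @^-1` A) = pr mu A.
  by move=> mA; rewrite /pr inv.
split=> // A mA invA.
have miter n E : measurable E -> measurable (iter n left_shift @^-1` E).
  elim: n => // n IH mE; rewrite -[X in measurable X]setTI.
  have -> : iter n.+1 left_shift @^-1` E = left_shift @^-1` (iter n left_shift @^-1` E).
    exact: preimage_iter_shiftS.
  by apply: measurable_left_shift => //; exact: IH.
have AE n E : measurable E ->
    pr mu (A `&` iter n left_shift @^-1` E) = pr mu (A `&` E).
  move=> mE; elim: n => [//|n IH]; rewrite -IH -[RHS]prinv.
    by rewrite preimage_setI invA -preimage_iter_shiftS.
  by apply: measurableI => //; exact: miter.
have mAX : measurable (A `&` block_shift) by exact: measurableI.
have prIX B : measurable B -> pr mu (B `&` block_shift) = pr mu B.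
  move=> mB; rewrite [RHS](pr_split mu mB mX) (_ : pr mu (_ `&` ~` _) = 0) ?addr0//.
  apply/eqP; rewrite eq_le pr_ge0 andbT.
  rewrite (_ : 0 = pr mu (~` block_shift)); last by rewrite prC// prX subrr.
  apply: pr_le; [|exact: measurableC|by move=> x []].
  by apply: measurableI => //; exact: measurableC.
have indep s E : findep s E -> pr mu (A `&` E) = pr mu A * mean R E.
  move=> hE; have mE := measurable_findep hE.
  suff H e : 0 < e -> `|pr mu (A `&` E) - pr mu A * mean R E| <= e.
    apply/eqP; rewrite -subr_eq0 -normr_le0; apply/ler_addgt0Pr => e e0.
    by rewrite add0r H.
  (* All intersections of [A] with the shifted preimages of [E] have the same mass, and on [A] the
     number of visits to [E] up to time [M] is almost constant, so the average of these masses is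
     near [mu A * mean E]. *)
  move=> e0; have [M [M0 h]] := near_mean hE e0.
  have M0' : (0 : R) < M%:R by rewrite ltr0n.
  have := @pr_count_bounds _ _ _ mu M (A `&` block_shift)
    (fun i => iter i left_shift @^-1` E)
    ((mean R E - e) * M%:R) ((mean R E + e) * M%:R) mAX (fun i => miter i E mE).
  have -> : \sum_(i < M) pr mu (A `&` block_shift `&` iter i left_shift @^-1` E)
      = M%:R * pr mu (A `&` E).
    rewrite (eq_bigr (fun=> pr mu (A `&` E))) => [|i _].
      by rewrite sumr_const card_ord mulr_natl.
    rewrite setIAC prIX; first exact: AE.
    by apply: measurableI => //; exact: miter.
  rewrite prIX// => /(_ _)/andP[].
    move=> t [At tX]; rewrite -natr_sum; have := h t tX.
    rewrite /hits ler_norml => /andP[? ?]; apply/andP; split; lra.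
  move=> h1 h2; have A1 := pr_le1 mu mA; have A0 := pr_ge0 mu A.
  have h1' : (mean R E - e) * pr mu A <= pr mu (A `&` E).
    by rewrite -(ler_pM2r M0'); lra.
  have h2' : pr mu (A `&` E) <= (mean R E + e) * pr mu A.
    by rewrite -(ler_pM2r M0'); lra.
  rewrite ler_norml; apply/andP; split; nra.
(* For a finitely dependent [E] close to [A], the intersection has mass near [mu A] and equal to
   [mu A * mu E]. *)
have H e : 0 < e -> `|pr mu A - pr mu A * pr mu A| <= e.
  move=> e0; have e2 : 0 < e / 2 by rewrite divr_gt0.
  have [E [s hE] hAE] := findep_approx mu mA e2.
  have mE := measurable_findep hE.
  have h1 := indep _ _ hE; rewrite -(muE _ _ hE) in h1.
  have h2 := pr_split mu mA mE; have h3 := pr_split mu mE mA.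
  have h4 : pr mu (symdiff A E) = pr mu (A `&` ~` E) + pr mu (E `&` ~` A).
    rewrite /symdiff !setDE prU//.
    - by apply: measurableI => //; exact: measurableC.
    - by apply: measurableI => //; exact: measurableC.
    - by apply/seteqP; split=> // x [[? ?] [? ?]].
  rewrite [E `&` A]setIC in h3.
  have := pr_ge0 mu (A `&` ~` E); have := pr_ge0 mu (E `&` ~` A).
  have A1 := pr_le1 mu mA; have A0 := pr_ge0 mu A.
  move=> p1 p2; rewrite ler_norml; apply/andP; split; nra.
have : pr mu A - pr mu A * pr mu A = 0.
  by apply/eqP; rewrite -normr_le0; apply/ler_addgt0Pr => e e0; rewrite add0r H.
rewrite -{1}[pr mu A]mulr1 -mulrBr => /eqP; rewrite mulf_eq0 subr_eq0.
by case/orP => /eqP; [left|right].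
Qed.

End frequency_measure.

(** By [word_rare], at most [3 l] of [L = N * l] consecutive shifts of a point of [X] start with
    [s]; by invariance each of these shifts has the same probability to do so. *)
Lemma word_probability (R : realType) (P : probability Sigma R) k s :
  pr P block_shift = 1 ->
  (forall A, measurable A -> P (left_shift @^-1` A) = P A) ->
  pr P [set t | window (trace t 0) 0 (2 * blen k) = s]
    <= 3 / (size (blocks k))%:R.
Proof.
move=> PX inv.
set B := [set t : Sigma | _]; pose L := blen k.+1.
have hB : findep [seq i%:Z | i <- iota 0 (2 * blen k)] B.
  move=> t t' tt' Bt; rewrite /B /mkset -[RHS]Bt; apply: eq_window => i il.
  rewrite /trace !add0r tt'//; apply/mapP; exists i => //.
  by rewrite mem_iota.
have mB : measurable B := measurable_findep hB.
have miter n : measurable (iter n left_shift @^-1` B).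
  exact: measurable_findep (findep_shift (n:=n) hB).
have PB n : pr P (iter n left_shift @^-1` B) = pr P B.
  elim: n => // n IH; by rewrite -IH [RHS]/pr -inv// -preimage_iter_shiftS.
have mX := measurable_block_shift.
have := @pr_count_bounds _ _ _ P L block_shift
  (fun i => iter (L + i) left_shift @^-1` B) 0 (3 * blen k)%:R mX
  (fun i => miter _).
move=> /(_ _)/andP[].
  move=> t tX; rewrite sumr_ge0//= -natr_sum ler_nat.
  have := word_rare s (leqnn _) (tX k.+1 _ 0).
  congr (_ <= _)%N; apply: eq_bigr => i _; congr nat_of_bool.
  rewrite /B /= /preimage /= window_iter_shift addn0.
  by apply/eqP/asboolP.
move=> _; rewrite PX mulr1 (eq_bigr (fun=> pr P B)) => [|i _]; last first.
  rewrite -[RHS](PB (L + i)%N) [RHS](pr_split P _ mX)// setIC.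
  rewrite (_ : pr P (_ `&` ~` _) = 0) ?addr0//.
  apply/eqP; rewrite eq_le pr_ge0 andbT.
  rewrite (_ : 0 = pr P (~` block_shift)); last by rewrite prC// PX subrr.
  apply: pr_le; [|exact: measurableC|by move=> x []].
  by apply: measurableI => //; exact: measurableC.
rewrite sumr_const card_ord -mulr_natr /L /= !natrM => h.
have N0 : (0 : R) < (size (blocks k))%:R.
  by rewrite ltr0n; have := size_blocks_ge16 k; lia.
have l0 : (0 : R) < (blen k)%:R by rewrite ltr0n blen_gt0.
rewrite ler_pdivlMr// -(ler_pM2r l0); lra.
Qed.

(** * Entropy and energy *)

Lemma ge_limn_esup (R : realType) (u : (\bar R)^nat) (c : \bar R) :
  (forall N, exists2 n, (N <= n)%N & (c <= u n)%E) -> (c <= limn_esup u)%E.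
Proof.
move=> h; rewrite limn_esup_lim; apply: lime_ge; first exact: is_cvg_esups.
apply: nearW => N; have [n Nn cn] := h N.
by apply: le_trans cn _; apply: ereal_sup_ubound; exists n.
Qed.

Lemma le_limn_esup (R : realType) (u : (\bar R)^nat) (c : \bar R) :
  (forall n, (u n <= c)%E) -> (limn_esup u <= c)%E.
Proof.
move=> h; rewrite limn_esup_lim; apply: lime_le; first exact: is_cvg_esups.
by apply: nearW => N; apply: ge_ereal_sup => _ [n _ <-].
Qed.

(** The integral of a nonnegative function is the supremum over the simple functions below it, and
    this supremum grows with the function. *)
Lemma ge0_integral_le_cst d (T : measurableType d) (R : realType)
    (P : probability T R) (f : T -> \bar R) (c : R) :
  (forall x, 0 <= f x)%E -> (forall x, f x <= c%:E)%E ->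
  (\int[P]_x f x <= c%:E)%E.
Proof.
move=> f0 fc; rewrite ge0_integralTE//.
have <- : (\int[P]_x c%:E = c%:E)%E.
  by rewrite integral_cst//= probability_setT mule1.
rewrite ge0_integralTE; last by move=> x; exact: le_trans (fc x).
apply: le_ereal_sup => _ [h hf <-]; exists h => // x.
exact: le_trans (fc x).
Qed.

(** * Bounds on the entropy of a partition *)

Section partition_entropy.
Context d (T : measurableType d) (R : realType) (mu : probability T R).
Context (I : finType) (P : I -> set T).
Hypothesis mP : forall i, measurable (P i).

Lemma part_entropyE : part_entropy mu P = \sum_i - (pr mu (P i) * ln (pr mu (P i))).
Proof. by rewrite /part_entropy sumrN. Qed.

Lemma part_entropy_ge0 : 0 <= part_entropy mu P.
Proof.
rewrite part_entropyE sumr_ge0// => i _.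
by rewrite oppr_ge0 mulr_ge0_le0 ?pr_ge0// ln_le0// pr_le1.
Qed.

Context (f : T -> I).
Hypothesis mf : forall i, measurable [set x | f x = i].

Let sum_fibers : \sum_i pr mu [set x | f x = i] = 1.
Proof.
rewrite -[RHS](prT mu) (pr_sum_fiber mu measurableT mf).
by apply: eq_bigr => i _; rewrite setTI.
Qed.

(** The sets [P i] only lie inside the fibres of [f], so their total mass [S] may be less than 1;
    the estimate is [S * ln #|I| + 1 - S], whence the summand 1. *)
Lemma part_entropy_le : (forall i, P i `<=` [set x | f x = i]) ->
  part_entropy mu P <= ln #|I|%:R + 1.
Proof.
move=> Pf; rewrite part_entropyE.
have S1 : \sum_i pr mu (P i) <= 1.
  by rewrite -sum_fibers; apply: ler_sum => i _; exact: pr_le.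
have S0 : 0 <= \sum_i pr mu (P i) by apply: sumr_ge0 => i _; exact: pr_ge0.
have [I0|I0] := posnP #|I|.
  rewrite big1; last by move=> i _; have := card0_eq I0 i; rewrite inE.
  by rewrite I0 ln0// add0r.
have N0 : (0 : R) < #|I|%:R by rewrite ltr0n.
have lnN : 0 <= ln (#|I|%:R : R) by rewrite ln_ge0// ler1n.
(* Gibbs' inequality, from [ln y <= y - 1] at [y = 1 / (N p)] *)
have term i : - (pr mu (P i) * ln (pr mu (P i))) <=
    pr mu (P i) * ln #|I|%:R + (#|I|%:R^-1 - pr mu (P i)).
  have := pr_ge0 mu (P i); rewrite le_eqVlt => /predU1P[<-|p0].
    by rewrite !mul0r oppr0 add0r addr0 invr_ge0 ltW.
  set p := pr mu _ in p0 *; set N := #|I|%:R in N0 *.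
  have q0 : 0 < (N * p)^-1 by rewrite invr_gt0 mulr_gt0.
  have := @le_ln1Dx R ((N * p)^-1 - 1) ltac:(lra).
  rewrite addrC subrK lnV ?posrE ?mulr_gt0// lnM ?posrE// => h.
  have -> : N^-1 = p * (N * p)^-1 by field; rewrite !gt_eqF.
  have := ler_wpM2l (ltW p0) h; lra.
rewrite (le_trans (ler_sum _ (fun i _ => term i)))//.
have I1 : \sum_(i : I) #|I|%:R^-1 = 1 :> R.
  by rewrite sumr_const -[LHS]mulr_natr mulVf ?gt_eqF.
rewrite big_split/= -mulr_suml sumrB I1.
have := ler_wpM2r lnN S1; lra.
Qed.

(** Here the sets are the whole fibres, so the entropy is an average of the numbers [- ln p] with
    every [p <= q]. *)
Lemma part_entropy_ge (q : R) : 0 < q -> (forall i, P i = [set x | f x = i]) ->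
  (forall i, pr mu (P i) <= q) -> - ln q <= part_entropy mu P.
Proof.
move=> q0 Pf pq; rewrite part_entropyE.
have -> : - ln q = \sum_i - (pr mu (P i) * ln q).
  rewrite sumrN -mulr_suml (eq_bigr _ (fun i _ => congr1 (pr mu) (Pf i))).
  by rewrite sum_fibers mul1r.
apply: ler_sum => i _; rewrite lerN2.
have := pr_ge0 mu (P i); rewrite le_eqVlt => /predU1P[<-|p0].
  by rewrite !mul0r.
by apply: ler_wpM2l; [exact: ltW|rewrite ler_ln ?posrE//; exact: pq].
Qed.

End partition_entropy.

Section itinerary.
Context d (T : measurableType d) (I : finType) (f : T -> T) (g : T -> I).

Definition itinerary n (x : T) : n.-tuple I := [tuple g (iter i f x) | i < n].

Lemma refinement_itinerary n (w : n.-tuple I) :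
  refinement f (fun i => [set x | g x = i]) w = [set x | itinerary n x = w].
Proof.
apply/seteqP; split=> x /=.
  by move=> h; apply: eq_from_tnth => i; rewrite tnth_mktuple; exact: h.
by move=> <- i _ /=; rewrite tnth_mktuple.
Qed.

Lemma measurable_refinement n (J : Type) (P : J -> set T) (w : n.-tuple J) :
  (forall j, measurable (P j)) -> measurable_fun setT f ->
  measurable (refinement f P w).
Proof.
move=> mP mf; apply: fin_bigcap_measurable => [|i _]; first exact: finite_finset.
rewrite -[X in measurable X]setTI.
have : measurable_fun setT (iter i f).
  elim: (nat_of_ord i) => [|m IH]; first exact: measurable_id.
  exact: (measurableT_comp mf IH).
by move=> mi; apply: mi.
Qed.

Lemma measurable_itinerary n (w : n.-tuple I) :
  (forall i, measurable [set x | g x = i]) -> measurable_fun setT f ->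
  measurable [set x | itinerary n x = w].
Proof.
by move=> mg mf; rewrite -refinement_itinerary; exact: measurable_refinement.
Qed.

End itinerary.

Section product_system.
Context (R : realType).
Implicit Types (eta : probability (Sigma * Sigma)%type R).

Lemma measurable_prod_map : measurable_fun setT prod_map.
Proof.
by apply: measurable_fun_pair; apply: measurableT_comp => //;
  exact: measurable_left_shift.
Qed.

Lemma iter_prod_map n x :
  iter n prod_map x = (iter n left_shift x.1, iter n left_shift x.2).
Proof. by elim: n => [|n IH]; [case: x|rewrite iterS IH]. Qed.

Lemma ks_entropy_base eta :
  (ks_entropy left_shift (distribution eta base) <= ks_entropy prod_map eta)%E.
Proof.
apply: le_ereal_sup => _ [k [P [[mP tP cP] ->]]].
exists k, (fun i => base @^-1` P i); split.
  split.
  - by move=> i; rewrite -[X in measurable X]setTI; exact: measurable_base.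
  - by move=> i j _ _ [x [xi xj]]; apply: (tP i j) => //; exists (base x).
  - by rewrite -preimage_bigcup cP preimage_setT.
rewrite /entropy_part; congr limn_esup; apply/funext => n; congr (_%:E).
congr (_ * _); rewrite /part_entropy; congr (- _); apply: eq_bigr => w _.
have -> : refinement prod_map (fun i => base @^-1` P i) w
    = base @^-1` refinement left_shift P w.
  by apply/seteqP; split=> x /= h i _; have := h i I;
    rewrite /= /base iter_prod_map.
by [].
Qed.

Lemma measurable_coord (i : int) b : measurable [set t : Sigma | t i = b].
Proof. by apply: (@measurable_findep _ [:: i]) => t t' tt' /= <-; rewrite tt' ?inE. Qed.

Definition agree : set (Sigma * Sigma) := [set x | x.1 0 = x.2 0].

Lemma measurable_agree : measurable agree.
Proof.
rewrite (_ : agree = ([set t | t 0 = true] `*` [set t | t 0 = true])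
    `|` ([set t | t 0 = false] `*` [set t | t 0 = false])).
  by apply: measurableU; apply: measurableX; exact: measurable_coord.
apply/seteqP; split=> -[w t] /=; rewrite /agree /=.
  by case: (w 0) => <-; [left|right].
by case=> -[-> ->].
Qed.

Definition coupling (K : R) (x : Sigma * Sigma) : R :=
  if x.1 0 == x.2 0 then K else 0.

Lemma couplingE K x : coupling K x = K * \1_agree x.
Proof.
rewrite /coupling indicE; case: eqP => h.
  by rewrite (_ : x \in agree) ?mulr1//; apply/mem_set.
by rewrite (_ : x \in agree = false) ?mulr0//; apply/negbTE/negP => /set_mem.
Qed.

Lemma energy_coupling X K eta : 0 <= K -> measurable X ->
  eta (setT `*` X) = 1%E ->
  energy X (coupling K) eta = (K * pr eta agree)%:E.
Proof.
move=> K0 mX e1; have mA := measurable_agree.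
have mTX : measurable (setT `*` X : set (Sigma * Sigma)) by exact: measurableX.
rewrite /energy (eq_integral (fun x => (K%:E * (\1_agree x)%:E)%E)); last first.
  by move=> x _; rewrite couplingE EFinM.
rewrite ge0_integralZl//; last 1 first.
- exact/measurable_EFinP/measurable_funTS/measurable_indic.
rewrite integral_indic//=.
rewrite [X in (_ * X)%E](prE eta (measurableI _ _ mA mTX)).
rewrite -EFinM; congr (_ * _)%:E.
rewrite [RHS](pr_split eta mA mTX) (_ : pr eta (_ `&` ~` _) = 0) ?addr0//.
apply/eqP; rewrite eq_le pr_ge0 andbT.
rewrite (_ : 0 = pr eta (~` (setT `*` X))); last by rewrite prC// /pr e1 subrr.
apply: pr_le; [|exact: measurableC|by move=> x []].
by apply: measurableI => //; exact: measurableC.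
Qed.

End product_system.

(** * Pressure of the coupling potential *)

Section coupling_pressure.
Context (R : realType).
Implicit Types (K : R) (eta : probability (Sigma * Sigma)%type R).

(** The first [n] terms only read coordinates fixed by the cylinder, so the sum is constant there
    and every point of the cylinder is a maximizer. *)
Lemma birkhoff_coupling K n (w : n.-tuple bool) (v t : Sigma) : cylinder w v ->
  birkhoff (coupling K) n (v, t) =
  \sum_(k < n) (if tnth w k == t k%:Z then K else 0).
Proof.
move=> vw; apply: eq_bigr => k _.
by rewrite /coupling iter_prod_map /= !iter_left_shift !add0r vw.
Qed.

Lemma cylinder_argmax K n (w : n.-tuple bool) (t : Sigma) :
  cylinder w (cyl_argmax (coupling K) w t).
Proof.
suff : exists v, cylinder w v /\ forall v', cylinder w v' ->
    birkhoff (coupling K) n (v', t) <= birkhoff (coupling K) n (v, t).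
  by move=> /getPex[].
pose v : Sigma := fun i => nth false w (absz i).
have vw : cylinder w v by move=> i; rewrite (tnth_nth false).
by exists v; split=> // v' v'w; rewrite !(@birkhoff_coupling K n w).
Qed.

Lemma sum_tuple_prod (n : nat) (F : 'I_n -> bool -> R) :
  \sum_(w : n.-tuple bool) \prod_(k < n) F k (tnth w k)
    = \prod_(k < n) (F k true + F k false).
Proof.
rewrite (eq_bigr (fun k => \sum_(b : bool) F k b)); last first.
  by move=> k _; rewrite big_bool.
rewrite bigA_distr_bigA/=.
rewrite (reindex (fun f : {ffun 'I_n -> bool} => [tuple f i | i < n]))/=.
  by apply: eq_bigr => f _; apply: eq_bigr => k _; rewrite tnth_mktuple.
exists (fun w : n.-tuple bool => [ffun i => tnth w i]) => [f _|w _].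
  by apply/ffunP => i; rewrite ffunE tnth_mktuple.
by apply: eq_from_tnth => i; rewrite tnth_mktuple ffunE.
Qed.

(** For a fixed [t] the sum over words factors over the coordinates, and each factor is [1 + e^K]
    whatever the bit of [t]. *)
Lemma poe_coupling_le X K : 0 <= K ->
  (poe X (coupling K) <= (ln (1 + expR K))%:E)%E.
Proof.
move=> K0; apply: le_limn_esup => n; apply: ge_ereal_sup => _ [t _ <-].
have eK := expR_gt0 K.
have -> : \sum_(w : n.-tuple bool)
    expR (birkhoff (coupling K) n (cyl_argmax (coupling K) w t, t))
    = (1 + expR K) ^+ n.
  rewrite (eq_bigr (fun w : n.-tuple bool => \prod_(k < n)
      expR (if tnth w k == t k%:Z then K else 0))); last first.
    move=> w _; rewrite (birkhoff_coupling _ _ (cylinder_argmax K w t)).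
    exact: expR_sum.
  rewrite (sum_tuple_prod (fun k b => expR (if b == t k%:Z then K else 0))).
  rewrite (eq_bigr (fun=> 1 + expR K)) ?prodr_const ?card_ord// => k _.
  by case: (t k%:Z); rewrite expR0// addrC.
rewrite lee_fin lnXn; last by rewrite addr_gt0.
have l0 : 0 <= ln (1 + expR K) by rewrite ln_ge0// lerDl ltW.
(* At [n = 0] the inverse is 0, and so is the term. *)
case: n => [|n]; first by rewrite mulr0n mulr0.
by rewrite -[ln _ *+ _]mulr_natl mulrA mulVf ?mul1r// pnatr_eq0.
Qed.

(** If the values differ, one of the two points changes at coordinate 0, which makes the distance at
    least 1; constant [K] and exponent 1 then suffice. *)
Lemma hoelder_coupling X K : 0 <= K -> hoelder_on X (coupling K).
Proof.
move=> K0; exists K, 1; split=> // x y _ _.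
have dist_ge1 (v w : Sigma) : v 0 != w 0 -> 1 <= seq_dist R v w.
  move=> vw; apply: ub_le_sup; last by exists 0.
  exists 1 => _ [i _ <-]; rewrite exprn_ile1//; lra.
have [->|ne] := eqVneq (coupling K x) (coupling K y).
  by rewrite subrr normr0 mulr_ge0// powR_ge0.
have m1 : 1 <= Num.max (seq_dist R x.1 y.1) (seq_dist R x.2 y.2).
  rewrite le_max; have [e1|/dist_ge1->//] := eqVneq (x.1 0) (y.1 0).
  have [e2|/dist_ge1->//] := eqVneq (x.2 0) (y.2 0); last by rewrite orbT.
  by move: ne; rewrite /coupling e1 e2 eqxx.
rewrite powRr1; last exact: le_trans m1.
rewrite (@le_trans _ _ K)//; last by rewrite ler_peMr.
by rewrite /coupling; case: eqP; case: eqP; rewrite ?subrr ?subr0 ?sub0r ?normrN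
  ?normr0// ger0_norm.
Qed.

(** For the partition by the bit at 0 and [n = 2 l = 10 a], each atom has mass at most
    [3 / N <= 2 ^ (- a)], so the entropy is at least [a ln 2 = n ln 2 / 10] for infinitely many
    [n]. *)
Lemma ks_entropy_block_shift_ge (mu : probability Sigma R) :
  pr mu block_shift = 1 ->
  (forall A, measurable A -> mu (left_shift @^-1` A) = mu A) ->
  ((ln 2 / 10)%:E <= ks_entropy left_shift mu)%E.
Proof.
move=> muX inv.
pose g (t : Sigma) : 'I_2 := inord (t 0%Z : bool).
pose P (i : 'I_2) := [set t : Sigma | g t = i].
have mg i : measurable [set t | g t = i].
  apply: (@measurable_findep _ [:: 0]) => t t' tt' /= <-.
  by rewrite /g tt' ?inE.
apply: (@le_trans _ _ (entropy_part left_shift mu P)); last first.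
  apply: ereal_sup_ubound; exists 2, P; split=> //; split=> //.
  - by move=> i j _ _ [t [/= <- <-]].
  - by apply/seteqP; split=> // t _; exists (g t).
apply: ge_limn_esup => k; exists (2 * blen k)%N.
  by have := blen_gt k; lia.
rewrite lee_fin; set n := (2 * blen k)%N.
have /andP[d5 hN] := blen_size_blocks k.
set N := size (blocks k) in hN; set a := (blen k %/ 5)%N in hN.
have nE : n = (10 * a)%N by rewrite /n -(divnK d5) -/a; lia.
have a0 : (0 < a)%N by have := blen_gt0 k; rewrite -(divnK d5) -/a; lia.
have N0 : (0 : R) < N%:R by rewrite ltr0n; apply: leq_trans hN; rewrite muln_gt0 expn_gt0.
have q0 : (0 : R) < 3 / N%:R by rewrite divr_gt0.
have mR w : measurable (refinement left_shift P (w : n.-tuple 'I_2)).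
  by apply: measurable_refinement => //; exact: measurable_left_shift.
have mI w := @measurable_itinerary _ _ _ left_shift g n w mg measurable_left_shift.
have RE (w : n.-tuple 'I_2) : refinement left_shift P w
    = [set t | itinerary left_shift g n t = w] := refinement_itinerary _ _ _.
have hq (w : n.-tuple 'I_2) : pr mu (refinement left_shift P w) <= 3 / N%:R.
  pose s := [seq nat_of_ord i == 1%N | i <- w].
  rewrite (le_trans _ (@word_probability R mu k s muX inv))//.
  apply: pr_le => //.
    apply: (@measurable_findep _ [seq i%:Z | i <- iota 0 (2 * blen k)]).
    move=> t t' tt' Bt; rewrite /mkset -[RHS]Bt; apply: eq_window => i il.
    rewrite /trace !add0r tt'//; apply/mapP; exists i => //.
    by rewrite mem_iota.
  move=> t /= h; apply: (@eq_from_nth _ false).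
    by rewrite size_window /s size_map size_tuple.
  move=> i; rewrite size_window -/n => iln; rewrite nth_window//.
  rewrite (nth_map ord0) ?size_tuple//.
  have := h (Ordinal iln) Logic.I; rewrite /P /g /= iter_left_shift add0r.
  rewrite (tnth_nth ord0)/= => <-.
  by rewrite /trace !add0r inordK; case: (t _).
have := part_entropy_ge mI q0 RE hq.
have p2 : (0 : R) < 2 ^+ a by rewrite exprn_gt0.
have lnq : ln 2 *+ a <= - ln (3 / N%:R : R).
  rewrite -lnXn// -lnV ?posrE// ler_ln ?posrE ?invr_gt0// invf_div.
  rewrite ler_pdivlMr// mulrC.
  move: hN; rewrite -(ler_nat R) natrM natrX; apply: le_trans.
  by rewrite ler_pM2r// ler_nat.
move=> H; have {H} := le_trans lnq H; rewrite nE natrM => H.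
have a0' : (0 : R) < a%:R by rewrite ltr0n.
rewrite [X in _ <= X]mulrC ler_pdivlMr ?mulr_gt0//.
apply: le_trans H; rewrite -[X in _ <= X]mulr_natr le_eqVlt; apply/orP; left.
by apply/eqP; field.
Qed.

(** The image of the ergodic measure on [X] under the diagonal map, which intertwines the shift with
    [prod_map]. *)
Lemma ergodic_diagonal_ex : exists eta : probability (Sigma * Sigma)%type R,
  [/\ ergodic block_shift eta, pr eta agree = 1
    & ((ln 2 / 10)%:E <= ks_entropy left_shift (distribution eta base))%E].
Proof.
have [mu [muX inv erg]] := ergodic_block_shift_ex R.
pose diag (t : Sigma) := (t, t).
have mdiag : measurable_fun setT diag by exact: measurable_fun_pair.
have [eta etaE] := image_probability mu mdiag.
have mX := measurable_block_shift.
have mpre A : measurable A -> measurable (diag @^-1` A).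
  by move=> mA; rewrite -[X in measurable X]setTI; exact: mdiag.
exists eta; split.
- split.
    split.
      rewrite etaE (_ : diag @^-1` _ = block_shift); first by rewrite prE// muX.
      by apply/seteqP; split=> t; [case|split].
    move=> A mA; rewrite !etaE -[RHS]inv; last exact: mpre.
    by [].
  move=> A mA invA; rewrite etaE.
  have mD := mpre _ mA; rewrite prE//.
  have [|->|->] := erg _ mD; [|by left|by right].
  by rewrite -[in RHS]invA.
- rewrite /pr etaE (_ : diag @^-1` _ = setT) ?probability_setT//.
  by apply/seteqP; split.
- have bE A : distribution eta base A = mu A by rewrite /distribution/= /pushforward etaE.
  apply: ks_entropy_block_shift_ge; first by rewrite -muX; congr fine; exact: bE.
  by move=> A mA; exact: etrans (bE _) (etrans (inv _ mA) (esym (bE _))).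
Qed.

Lemma measurable_symbol_part X a : measurable X -> measurable (symbol_part X a).
Proof. by move=> mX; apply: measurableX => //; exact: measurable_coord. Qed.

(** The atoms are indexed by [2 ^ n] words, so the entropy is at most [n ln 2 + 1]. Such a crude
    bound suffices, as it is only weighed against the large constant [K]. *)
Lemma poe_entropy_bounds X eta : measurable X ->
  (0 <= poe_entropy X eta <= 2%:E)%E.
Proof.
move=> mX.
have mA n (w : n.-tuple bool) : measurable (refinement prod_map (symbol_part X) w).
  apply: measurable_refinement => [a|]; first exact: measurable_symbol_part.
  exact: measurable_prod_map.
pose g (x : Sigma * Sigma) := x.1 0%Z : bool.
have mI n (w : n.-tuple bool) : measurable [set x | itinerary prod_map g n x = w].
  apply: measurable_itinerary => [b|]; last exact: measurable_prod_map.
  rewrite (_ : mkset _ = [set t : Sigma | t 0 = b] `*` setT).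
    by apply: measurableX => //; exact: measurable_coord.
  by apply/seteqP; split=> -[w' t] //= [].
have sub n (w : n.-tuple bool) : refinement prod_map (symbol_part X) w `<=`
    [set x | itinerary prod_map g n x = w].
  rewrite -refinement_itinerary => x h i _.
  by have [] := h i Logic.I.
pose u n y := (n%:R^-1 * part_entropy (disintegration eta past_fiber y)
  (fun w : n.-tuple bool => refinement prod_map (symbol_part X) w))%:E.
have u0 n y : (0 <= u n y)%E.
  by rewrite lee_fin mulr_ge0// part_entropy_ge0.
have u2 n y : (u n y <= 2%:E)%E.
  rewrite lee_fin; case: n => [|n]; first by rewrite invr0 mul0r.
  have n0 : (0 : R) < n.+1%:R by rewrite ltr0n.
  rewrite mulrC ler_pdivrMr//.
  have := part_entropy_le (disintegration eta past_fiber y)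
    (@mA n.+1) (@mI n.+1) (@sub n.+1).
  move=> /le_trans; apply.
  rewrite card_tuple card_bool natrX lnXn// -[ln _ *+ _]mulr_natr.
  have n1 : (1 : R) <= n.+1%:R by rewrite ler1n.
  have l1 : ln (2 : R) <= 1 by apply: (@le_ln1Dx R 1); lra.
  by have := ler_wpM2r (ltW n0) l1; lra.
apply/andP; split.
  apply: ge_limn_esup => N; exists N => //; apply: integral_ge0 => y _; exact: u0.
apply: le_limn_esup => n.
by apply: ge0_integral_le_cst => y; [exact: u0|exact: u2].
Qed.

(** Comparison with the diagonal measure, whose value is at least [K], while that of [eta] is at
    most [2 + K * pr eta agree]. *)
Lemma poe_maximizer_disagree K eta : 0 < K ->
  poe_maximizer block_shift (coupling K) eta -> pr eta (~` agree) <= 2 / K.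
Proof.
move=> K0 [[etaX inv] opt].
have [eta' [[inv' _] agr _]] := ergodic_diagonal_ex.
have mX := measurable_block_shift.
have e' : energy block_shift (coupling K) eta' = K%:E.
  by rewrite energy_coupling ?ltW// ?agr ?mulr1//; case: inv'.
have e := energy_coupling (ltW K0) mX etaX.
have := opt _ inv'; rewrite e e' prC; last exact: measurable_agree.
have /andP[h1 _] := poe_entropy_bounds eta' mX.
have /andP[h2 h3] := poe_entropy_bounds eta mX.
move: h1 h2 h3; case: (poe_entropy _ eta') => [r1| |] //;
  case: (poe_entropy _ eta) => [r2| |] //.
rewrite -!EFinD !lee_fin => h1 h2 h3 h4.
rewrite ler_pdivlMr//; lra.
Qed.

Lemma le_top_pressure X phi :
  (ereal_sup [set (ks_entropy left_shift (distribution eta base) +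
      energy X phi eta)%E | eta in ergodic X]
   <= top_pressure (R := R) X phi)%E.
Proof.
apply: ge_ereal_sup => _ [eta [inv _] <-].
apply: (@le_trans _ _ (ks_entropy prod_map eta + energy X phi eta)%E).
  by apply: leeD2r; exact: ks_entropy_base.
by apply: ereal_sup_ubound; exists eta.
Qed.

End coupling_pressure.

(** * Prediction from the past *)

Section predictor.
Context (R : realType).
Implicit Types (eta : probability (Sigma * Sigma)%type R).

Lemma measurable_set1_binseq (I : countType) (y : binseq I) : measurable [set y].
Proof.
rewrite (_ : [set y] = \bigcap_(i in [set: I]) [set t : binseq I | t i = y i]).
  rewrite -[X in measurable X]setCK; apply: measurableC.
  apply: measurable_open; apply: closed_openC; apply: closed_bigI => i _.
  by apply: (@closed_findep _ [:: i]) => t t' tt' /= <-; rewrite tt' ?inE.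
apply/seteqP; split=> [t -> //|t h]; apply/funext => i; exact: h.
Qed.

(* If [eta] had no disintegration, the default value of [disintegration] would
   be a Dirac mass at the zero sequences, which [X] does not contain. *)
Lemma is_disintegration_past_base (X : set Sigma) eta :
  measurable X -> ~ X (fun=> false) ->
  future_independent X eta ->
  is_disintegration eta past_base (disintegration eta past_base).
Proof.
move=> mX X0 fi; apply: getPex; apply: contrapT => /forallNP nex.
have dE : disintegration eta past_base = point by exact: getPN.
have [N [mN N0 hN]] := fi.
have [v Nv] : exists v, ~ N v.
  apply: contrapT => /forallNP h.
  have NT : N = setT by apply/seteqP; split=> // v _; apply: contrapT; exact: h.
  move: N0; rewrite NT probability_setT => /eqP.
  by rewrite onee_eq0.
have [s [sX hs]] : exists sigma : probability Sigma R, sigma X = 1%E /\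
      forall A, measurable A ->
        disintegration eta past_base v A =
        (disintegration (distribution eta base) past v \x sigma)%E A.
  by apply: contrapT => h; apply: Nv; apply: hN.
have mTX : measurable (setT `*` X : set (Sigma * Sigma)) by exact: measurableX.
have := hs _ mTX; rewrite product_measure1E//= sX probability_setT mule1.
rewrite dE => h.
have : (dirac (point : Sigma * Sigma) (setT `*` X) : \bar R) = 1%E by rewrite -h.
rewrite diracE; case: (boolP (_ \in _)) => [/set_mem[_ /X0]//|_ /eqP].
by rewrite eq_sym onee_eq0.
Qed.

(** [B] consists of the pasts for which [t_0 = 1] has conditional probability at least 1/2. Given
    the past, the two bits are independent with probabilities [p] and [q] of being 1, and they
    disagree with probability [p (1 - q) + (1 - p) q]. This is an average of [1 - q] and [q], hence
    at least the smaller one, which is the error of the predictor. *)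
Lemma future_independent_predictor (X : set Sigma) eta :
  measurable X -> ~ X (fun=> false) ->
  future_independent X eta -> exists2 B : set SigmaM, measurable B &
  pr eta [set x : Sigma * Sigma | x.2 0 != `[< B (past_base x) >]] <= pr eta (~` agree).
Proof.
move=> mX X0 fi; have [mk etaE fib] := is_disintegration_past_base mX X0 fi.
set k := disintegration eta past_base in mk etaE fib.
pose S2 b : set (Sigma * Sigma) := [set x | x.2 0 = b].
pose S1 b : set (Sigma * Sigma) := [set x | x.1 0 = b].
have S2E b : S2 b = setT `*` [set t : Sigma | t 0 = b].
  by apply/seteqP; split=> -[w t] //= [].
have S1E b : S1 b = [set t : Sigma | t 0 = b] `*` setT.
  by apply/seteqP; split=> -[w t] //= [].
have mS2 b : measurable (S2 b).
  by rewrite S2E; apply: measurableX => //; exact: measurable_coord.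
have mS1 b : measurable (S1 b).
  by rewrite S1E; apply: measurableX => //; exact: measurable_coord.
pose B : set SigmaM := [set v | (2^-1%:E <= k v (S2 true))%E].
have mB : measurable B.
  rewrite -[B]setTI; apply: emeasurable_fun_c_infty => //; exact: mk.
exists B => //.
set bad : set (Sigma * Sigma) := [set x | _].
have badE : bad = (S2 true `&` past_base @^-1` (~` B))
    `|` (S2 false `&` past_base @^-1` B).
  apply/seteqP; split=> x; rewrite /bad /S2 /= .
    case: (x.2 0); have [Bx|nBx] := pselect (B (past_base x));
      rewrite ?(asboolT Bx) ?(asboolF nBx)// => _; by [left|right].
  by case=> -[-> h]; rewrite ?(asboolT h) ?(asboolF h).
have mpre (C : set SigmaM) : measurable C -> measurable (past_base @^-1` C).
  by move=> mC; rewrite -[X in measurable X]setTI; exact: measurable_past_base.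
have mbad : measurable bad.
  rewrite badE; apply: measurableU; apply: measurableI => //; apply: mpre => //.
  exact: measurableC.
have mD : measurable (~` agree) by apply: measurableC; exact: measurable_agree.
(* The inequality is proved on almost every fibre and integrated. *)
rewrite -lee_fin -!prE// !etaE//.
apply: ae_ge0_le_integral => //; [exact: mk|exact: mk|].
have fi' : {ae distribution eta past_base, forall v, exists sigma : probability Sigma R,
    sigma X = 1%E /\ forall A, measurable A ->
      k v A = (disintegration (distribution eta base) past v \x sigma)%E A}.
  exact: fi.
apply: filterS2 fib fi' => y fy [sig [sX hs]] _.
rewrite !prE// lee_fin.
set p := disintegration _ past y in hs.
have mfib : measurable (past_base @^-1` [set y]).
  by apply: mpre; exact: measurable_set1_binseq.
have q b : pr (k y) (S2 b) = pr sig [set t : Sigma | t 0 = b].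
  rewrite /pr S2E hs; last by rewrite -S2E.
  by rewrite product_measure1E//= ?probability_setT ?mul1e//; exact: measurable_coord.
have pq b c : pr (k y) (S1 b `&` S2 c) =
    pr p [set t : Sigma | t 0 = b] * pr sig [set t : Sigma | t 0 = c].
  have -> : S1 b `&` S2 c = [set t : Sigma | t 0 = b] `*` [set t : Sigma | t 0 = c].
    by apply/seteqP; split=> -[w t] [].
  have m1 := measurable_coord 0 b; have m2 := measurable_coord 0 c.
  apply: EFin_inj; rewrite EFinM -!prE//; last exact: measurableX.
  by rewrite hs ?product_measure1E//; exact: measurableX.
have c01 (P : probability Sigma R) : pr P [set t : Sigma | t 0 = false]
    = 1 - pr P [set t : Sigma | t 0 = true].
  rewrite -prC; last exact: measurable_coord.
  by congr pr; apply/seteqP; split=> t /=; case: (t 0).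
have DE : pr (k y) (~` agree) = pr (k y) (S1 true `&` S2 false)
    + pr (k y) (S1 false `&` S2 true).
  rewrite -prU; [|exact: measurableI|exact: measurableI|].
    congr pr; apply/seteqP; split=> x; rewrite /agree /S1 /S2 /=.
      by case: (x.1 0); case: (x.2 0) => // _; [left|right].
    by case=> -[h1 h2]; rewrite h1 h2.
  by apply/seteqP; split=> // x [[h1 _] [h2 _]]; move: h2; rewrite /S1 /= h1.
have fib0 : pr (k y) (~` (past_base @^-1` [set y])) = 0.
  by rewrite prC// /pr fy subrr.
(* The conditional measure is carried by one fibre of [past_base], where the prediction is a
   constant. *)
have bad_le b : (forall x, past_base x = y -> bad x -> S2 b x) ->
    pr (k y) bad <= pr (k y) (S2 b).
  move=> h; rewrite -[leRHS]addr0 -fib0.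
  rewrite (le_trans _ (prU_le _ _ _))//; last exact: measurableC.
  apply: pr_le => //; first by apply: measurableU => //; exact: measurableC.
  move=> x bx; have [xy|xy] := pselect (past_base x = y); last by right.
  by left; exact: h.
have p0 := pr_ge0 p [set t : Sigma | t 0 = true].
have p1 := pr_le1 p (measurable_coord 0 true).
have q0 := pr_ge0 sig [set t : Sigma | t 0 = true].
have q1 := pr_le1 sig (measurable_coord 0 true).
rewrite DE !pq !c01.
have [By|nBy] := pselect (B y).
  have h : pr (k y) bad <= pr (k y) (S2 false).
    apply: bad_le => x xy; rewrite badE => -[[_ nB]|[]//].
    by case: (nB : ~ B (past_base x)); rewrite xy.
  have := By; rewrite /B /= prE// lee_fin q => hq.
  rewrite (le_trans h)// q c01; nra.
have h : pr (k y) bad <= pr (k y) (S2 true).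
  apply: bad_le => x xy; rewrite badE => -[[]//|[_ xB]].
  by case: nBy; rewrite -xy.
have : pr (k y) (S2 true) < 2^-1.
  by rewrite -lte_fin -prE// ltNge; apply/negP.
rewrite q => hq; rewrite (le_trans h)// q; nra.
Qed.

End predictor.

(** * Words with few prediction errors *)

Section words_from_errors.
Context (R : realType).

Definition weight n (e : {ffun 'I_n -> bool}) : nat := \sum_(i < n) e i.

Lemma sum_weight n (z : R) :
  \sum_(e : {ffun 'I_n -> bool}) z ^+ weight e = (1 + z) ^+ n.
Proof.
rewrite (eq_bigr (fun e : {ffun 'I_n -> bool} => \prod_(i < n) z ^+ e i));
  last by move=> e _; rewrite prodrXr.
rewrite -(bigA_distr_bigA (fun=> fun b : bool => z ^+ b))/=.
rewrite (eq_bigr (fun=> 1 + z)) ?prodr_const ?card_ord// => i _.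
by rewrite big_bool expr0 expr1 addrC.
Qed.

(** A Chernoff bound: each counted pair contributes at least 1 to the sum of [q ^ (s - weight)], and
    the generating function of the weight is a power of [1 + q^-1]. *)
Lemma card_small_weight n s (q : R) : 1 <= q ->
  \sum_(e : {ffun 'I_n -> bool} * {ffun 'I_n -> bool})
     ((weight e.1 + weight e.2 <= s)%N : nat)%:R
    <= q ^+ s * (1 + q^-1) ^+ (n + n).
Proof.
move=> q1; have q0 : 0 < q := lt_le_trans ltr01 q1.
rewrite exprD -!sum_weight big_distrlr/= pair_bigA/= mulr_sumr.
apply: ler_sum => -[e1 e2] _ /=; rewrite -exprD.
case: leqP => [h|_]; last by rewrite mulr_ge0 ?exprn_ge0 ?invr_ge0 ?ltW.
by rewrite exprVn -expfB_cond ?gt_eqF// ?exprn_ege1//.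
Qed.

End words_from_errors.

(** * Coding of words by prediction errors *)

Section error_coding.
Context (m : nat) (se : seq nat) (E : set SigmaM).
Hypothesis hE : findep se E.
Hypothesis se_lt : forall j, j \in se -> (j < m)%N.

(** The predictor is tested on [w_0] rather than on [t_0]: a recovered bit of [w] then joins the
    past from which the next one is predicted. *)
Definition mispredicted : set (Sigma * Sigma) :=
  [set x | x.1 0 != `[< E (past_base x) >]].

Definition past_word (x : Sigma * Sigma) : {ffun 'I_m -> bool} :=
  [ffun j : 'I_m => `[< x.1 (Negz j) >]].

Definition error_word (A : set (Sigma * Sigma)) n x : {ffun 'I_n -> bool} :=
  [ffun i : 'I_n => `[< (iter i prod_map @^-1` A) x >]].

Lemma error_word_determines n x y : past_word x = past_word y ->
  error_word mispredicted n x = error_word mispredicted n y ->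
  error_word (~` agree) n x = error_word (~` agree) n y ->
  forall i, (i < n)%N -> x.2 i%:Z = y.2 i%:Z.
Proof.
move=> exy hxy dxy.
have pE k : (k < m)%N -> x.1 (Negz k) = y.1 (Negz k).
  move=> km; have := congr1 (fun f => fun_of_fin f (Ordinal km)) exy.
  by rewrite !ffunE !asboolb.
have hP i : (i < n)%N ->
    ((iter i prod_map x).1 0 != `[< E (past_base (iter i prod_map x)) >]) =
    ((iter i prod_map y).1 0 != `[< E (past_base (iter i prod_map y)) >]).
  move=> iln; have := congr1 (fun f => fun_of_fin f (Ordinal iln)) hxy.
  by rewrite !ffunE /preimage /mispredicted /mkset !asboolb.
have dP i : (i < n)%N ->
    ((~` agree) (iter i prod_map x) <-> (~` agree) (iter i prod_map y)).
  move=> iln; have := congr1 (fun f => fun_of_fin f (Ordinal iln)) dxy.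
  rewrite !ffunE => h.
  have h' : `[< (~` agree) (iter i prod_map x) >] =
      `[< (~` agree) (iter i prod_map y) >] by exact: h.
  by split=> k; apply/asboolP; [rewrite -h'|rewrite h']; exact/asboolP.
(* The prediction at time [i] reads positions from [i - m] to [i - 1]: the negative ones belong to
   the given past word, the others are already recovered. *)
have base_eq i : (i <= n)%N -> forall j, (j < i)%N -> x.1 j%:Z = y.1 j%:Z.
  elim: i => // i IH iln j; rewrite ltnS leq_eqVlt => /predU1P[->|]; last first.
    exact: IH (ltnW iln) _.
  have EE : E (past_base (iter i prod_map x)) <-> E (past_base (iter i prod_map y)).
    have h : {in se, past_base (iter i prod_map x) =1 past_base (iter i prod_map y)}.
      move=> k /se_lt km; rewrite /past_base /past !iter_prod_map /= !iter_left_shift.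
      have [ki|ik] := ltnP k i.
        have -> : Negz k + i%:Z = (i - k.+1)%N%:Z by lia.
        by apply: IH; [exact: ltnW|lia].
      have -> : Negz k + i%:Z = Negz (k - i) by lia.
      by apply: pE; lia.
    by split; apply: hE => k ks; rewrite h.
  have := hP i iln; rewrite (asbool_equiv_eq EE).
  rewrite !iter_prod_map /= !iter_left_shift !add0r.
  by case: (x.1 _); case: (y.1 _); case: `[< _ >].
move=> i iln; have := dP i iln; have := base_eq n (leqnn n) i iln.
rewrite /agree /setC /= !iter_prod_map /= !iter_left_shift !add0r => ->.
case: (y.1 _); case: (x.2 _); case: (y.2 _) => // -[h1 h2]; exfalso;
  first [by apply: h1 | by apply: h2].
Qed.

End error_coding.

Section few_errors.
Context (R : realType) (eta : probability (Sigma * Sigma)%type R).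
Hypothesis inv : Defs.invariant block_shift eta.
Context (m : nat) (se : seq nat) (E : set SigmaM).
Hypothesis hE : findep se E.
Hypothesis se_lt : forall j, j \in se -> (j < m)%N.

Lemma measurable_mispredicted (B : set SigmaM) : measurable B ->
  measurable (mispredicted B).
Proof.
move=> mB.
have m0 b : measurable [set x : Sigma * Sigma | x.1 0 = b].
  rewrite (_ : mkset _ = [set t : Sigma | t 0 = b] `*` setT).
    by apply: measurableX => //; exact: measurable_coord.
  by apply/seteqP; split=> -[w t] //= [].
have mp : measurable (past_base @^-1` B).
  by rewrite -[X in measurable X]setTI; exact: measurable_past_base.
rewrite (_ : mispredicted B =
    ([set x | x.1 0 = true] `&` ~` (past_base @^-1` B))
    `|` ([set x | x.1 0 = false] `&` (past_base @^-1` B))).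
  by apply: measurableU; apply: measurableI => //; exact: measurableC.
apply/seteqP; split=> x; rewrite /mispredicted /=.
  by case: (x.1 0); case: asboolP => // h _; [left|right].
by case=> -[-> h]; case: asboolP.
Qed.

Lemma measurable_iter_prod_map i (A : set (Sigma * Sigma)) : measurable A ->
  measurable (iter i prod_map @^-1` A).
Proof.
move=> mA; rewrite -[X in measurable X]setTI.
have mi : measurable_fun setT (iter i prod_map).
  elim: i => [|i IH]; first exact: measurable_id.
  exact: (measurableT_comp measurable_prod_map IH).
exact: mi.
Qed.

Lemma pr_iter_prod_map i (A : set (Sigma * Sigma)) : measurable A ->
  pr eta (iter i prod_map @^-1` A) = pr eta A.
Proof.
move=> mA; elim: i => // i IH; rewrite -IH.
have -> : iter i.+1 prod_map @^-1` A = prod_map @^-1` (iter i prod_map @^-1` A).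
  by apply/funext => x; rewrite /preimage /mkset iterSr.
by rewrite /pr inv.2//; exact: measurable_iter_prod_map.
Qed.

Let H : set (Sigma * Sigma) := mispredicted E.
Let D : set (Sigma * Sigma) := ~` agree.

Let mH : measurable H.
Proof. exact: measurable_mispredicted (measurable_findep hE). Qed.

Let mD : measurable D.
Proof. by apply: measurableC; exact: measurable_agree. Qed.

Definition few_errors n s : set (Sigma * Sigma) :=
  [set x | (weight (error_word H n x) + weight (error_word D n x) <= s)%N].

Let code n x := (past_word m x, (error_word H n x, error_word D n x)).

Let measurable_code n c : measurable [set x | code n x = c].
Proof.
case: c => c1 [c2 c3].
rewrite (_ : mkset _ = [set x | past_word m x = c1] `&`
    ([set x | error_word H n x = c2] `&` [set x | error_word D n x = c3])).
  apply: measurableI; [|apply: measurableI].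
  - pose B (j : 'I_m) : set (Sigma * Sigma) :=
      [set x : Sigma * Sigma | x.1 (Negz j) : bool].
    apply: (@measurable_pattern _ _ m B c1) => j; rewrite /B.
    rewrite (_ : mkset _ = [set t : Sigma | t (Negz j) = true] `*` setT).
      by apply: measurableX => //; exact: measurable_coord.
    by apply/seteqP; split=> -[w t] //= [].
  - by apply: measurable_pattern => i; exact: measurable_iter_prod_map.
  - by apply: measurable_pattern => i; exact: measurable_iter_prod_map.
by apply/seteqP; split=> x /=; rewrite /code; [case|case=> -> [-> ->]].
Qed.

Lemma measurable_few_errors n s : measurable (few_errors n s).
Proof.
rewrite (_ : few_errors n s = \bigcup_(c in
    [set c : {ffun 'I_m -> bool} * ({ffun 'I_n -> bool} * {ffun 'I_n -> bool}) |
      (weight c.2.1 + weight c.2.2 <= s)%N]) [set x | code n x = c]).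
  by apply: fin_bigcup_measurable => [|c _]; [exact: finite_finset|].
apply/seteqP; split=> x; first by move=> h; exists (code n x).
by case=> c /= h xc; move: h; rewrite -xc.
Qed.

(** Markov's inequality for [2 n] events: outside of [few_errors] at least [s + 1] of them occur,
    and by invariance their probabilities do not depend on time. *)
Lemma pr_many_errors n s :
  (s.+1)%:R * pr eta (~` few_errors n s) <= n%:R * (pr eta H + pr eta D).
Proof.
pose B (j : 'I_(n + n)) : set (Sigma * Sigma) := match fintype.split j with
  | inl i => iter i prod_map @^-1` H | inr i => iter i prod_map @^-1` D end.
have mB j : measurable (B j).
  by rewrite /B; case: fintype.split => i; exact: measurable_iter_prod_map.
have mA : measurable (~` few_errors n s).
  by apply: measurableC; exact: measurable_few_errors.
have := @pr_count_bounds _ _ _ eta (n + n) (~` few_errors n s) B s.+1%:R (n + n)%:R mA mB.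
have Bl (i : 'I_n) : B (lshift n i) = iter i prod_map @^-1` H.
  by rewrite /B -[lshift n i]/(unsplit (inl i)) unsplitK.
have Br (i : 'I_n) : B (rshift n i) = iter i prod_map @^-1` D.
  by rewrite /B -[rshift n i]/(unsplit (inr i)) unsplitK.
move=> /(_ _)/andP[].
  move=> x /negP; rewrite /few_errors /= -ltnNge => sx.
  rewrite -natr_sum !ler_nat sum_bool_le andbT (leq_trans sx)// big_split_ord.
  rewrite leq_add// /weight leq_eqVlt; apply/orP; left; apply/eqP;
    apply: eq_bigr => i _; rewrite ffunE.
    by rewrite -Bl.
  by rewrite -Br.
move=> h _; apply: (le_trans h); rewrite big_split_ord mulrDr.
apply: lerD.
  rewrite mulr_natl -[n in leRHS]card_ord -sumr_const; apply: ler_sum => i _.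
  rewrite Bl -(pr_iter_prod_map i mH); apply: pr_le => //.
  - by apply: measurableI => //; exact: measurable_iter_prod_map.
  - exact: measurable_iter_prod_map.
rewrite mulr_natl -[n in leRHS]card_ord -sumr_const; apply: ler_sum => i _.
rewrite Br -(pr_iter_prod_map i mD); apply: pr_le => //.
- by apply: measurableI => //; exact: measurable_iter_prod_map.
- exact: measurable_iter_prod_map.
Qed.

Lemma pr_second_word k s :
  pr eta [set x | window (trace x.2 0) 0 (2 * blen k) = s]
    <= 3 / (size (blocks k))%:R.
Proof.
have [P PE] := image_probability eta (@measurable_snd _ _ Sigma Sigma).
have mX := measurable_block_shift.
have -> : pr eta [set x | window (trace x.2 0) 0 (2 * blen k) = s]
    = pr P [set t | window (trace t 0) 0 (2 * blen k) = s].
  by rewrite /pr PE.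
apply: word_probability.
  rewrite /pr PE (_ : snd @^-1` _ = setT `*` block_shift); first by rewrite inv.1.
  by apply/seteqP; split=> -[w t] //= [].
move=> A mA; rewrite !PE -[RHS]inv.2//.
by rewrite -[X in measurable X]setTI; exact: measurable_snd.
Qed.

(* Where there are few errors, the word read on the second factor is determined
   by finitely many past coordinates and the positions of the errors. *)
Lemma pr_few_errors_le k s (q : R) : 1 <= q ->
  pr eta (few_errors (2 * blen k) s) <=
  2 ^+ m * (q ^+ s * (1 + q^-1) ^+ (2 * blen k + 2 * blen k))
    * (3 / (size (blocks k))%:R).
Proof.
move=> q1; set n := (2 * blen k)%N; set r := 3 / _.
have mG := measurable_few_errors n s.
have r0 : 0 <= r by rewrite divr_ge0.
rewrite (pr_sum_fiber eta mG (@measurable_code n)).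
(* All points with a given code show the same word on the second factor as a chosen point [y], so
   the class has at most the probability of one word. *)
have term c : pr eta (few_errors n s `&` [set x | code n x = c])
    <= ((weight c.2.1 + weight c.2.2 <= s)%N : nat)%:R * r.
  have [->|/set0P[y [Gy /= yc]]] :=
      eqVneq (few_errors n s `&` [set x | code n x = c]) set0.
    by rewrite pr0 mulr_ge0.
  rewrite -yc /= Gy mul1r.
  apply: le_trans (pr_second_word k (window (trace y.2 0) 0 n)).
  apply: pr_le.
  - exact: measurableI.
  - rewrite (_ : mkset _ = setT `*`
        [set t : Sigma | window (trace t 0) 0 n = window (trace y.2 0) 0 n]).
      apply: measurableX => //.
      apply: (@measurable_findep _ [seq i%:Z | i <- iota 0 n]).
      move=> t t' tt' Bt; rewrite /mkset -[RHS]Bt; apply: eq_window => i il.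
      rewrite /trace !add0r tt'//; apply/mapP; exists i => //.
      by rewrite mem_iota.
    by apply/seteqP; split=> -[w t] //= [].
  - move=> x [_ /= xy]; apply: eq_window => i iln; rewrite /trace !add0r !add0n.
    move: xy; rewrite /code => -[e1 e2 e3].
    exact: (error_word_determines hE se_lt e1 e2 e3 iln).
rewrite (le_trans (ler_sum _ (fun c _ => term c)))//.
rewrite -mulr_suml ler_wpM2r//.
rewrite -(pair_bigA _ (fun (c1 : {ffun 'I_m -> bool})
  (c2 : {ffun 'I_n -> bool} * {ffun 'I_n -> bool}) =>
    ((weight c2.1 + weight c2.2 <= s)%N : nat)%:R))/=.
rewrite sumr_const -[leLHS]mulr_natl card_ffun card_bool card_ord natrX.
by rewrite ler_wpM2l ?exprn_ge0// card_small_weight.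
Qed.

End few_errors.

(** * Conclusion *)

Lemma ln2_ge_half (R : realType) : 1 / 2 <= ln 2 :> R.
Proof.
rewrite -[1 / 2]expRK ler_ln ?posrE ?expR_gt0//.
have := @expR_ge1Dx R (- (1 / 2)); rewrite expRN => h.
rewrite -[leLHS]invrK -[leRHS]invrK lef_pV2 ?posrE ?invr_gt0 ?expR_gt0//.
by apply: le_trans h; lra.
Qed.

(* There are at least [2 ^ (n / 10)] blocks of level [k], while [s <= n / 320]
   errors give at most [2 ^ m * 2 ^ (8 s + n / 64)] codes; the constants are
   chosen so that [n / 10 > m + 8 s + n / 64]. *)
Lemma few_words_contradiction (R : realType) m k s (q : R) (n := (2 * blen k)%N) :
  q = 2 ^+ 8 ->
  (10 * m.+1 <= k)%N -> (320 * s <= n)%N ->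
  1 / 2 <= 2 ^+ m * (q ^+ s * (1 + q^-1) ^+ (n + n))
    * (3 / (size (blocks k))%:R) :> R -> False.
Proof.
move=> qE mk sn h; have q0 : 0 < q by rewrite qE exprn_gt0.
have qV0 : 0 < q^-1 by rewrite invr_gt0.
have /andP[d5 hN] := blen_size_blocks k.
set a := (blen k %/ 5)%N in hN; set N := size (blocks k) in hN h.
have nE : n = (10 * a)%N by rewrite /n -(divnK d5) -/a; lia.
have kn : (2 * k <= n)%N by have := blen_gt k; rewrite /n; lia.
have N0 : (0 : R) < N%:R.
  by rewrite ltr0n; apply: leq_trans hN; rewrite muln_gt0 expn_gt0.
(* With [q = 256] the bound is [e ^ (n / 128)], at most [2 ^ (n / 64)] because [ln 2 >= 1 / 2]. *)
have eq : (1 + q^-1) ^+ (n + n) <= expR ((n + n)%:R / q).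
  rewrite expRM_natl; apply: lerXn2r.
  - by rewrite nnegrE; lra.
  - by rewrite nnegrE expR_ge0.
  - exact: expR_ge1Dx.
have pq : q ^+ s = 2 ^+ (8 * s) by rewrite qE exprM.
have h2 : 2 ^+ a <= 2 ^+ (m + 8 * s) * expR ((n + n)%:R / q) :> R.
  have hN' : 16 * 2 ^+ a <= N%:R :> R.
    by move: hN; rewrite -(ler_nat R) natrM natrX.
  have h3 : N%:R <= 6 * (2 ^+ m * (q ^+ s * (1 + q^-1) ^+ (n + n))) :> R.
    by move: h; rewrite [leRHS]mulrA ler_pdivlMr//; lra.
  have p0 : (0 : R) <= 2 ^+ m * q ^+ s by rewrite mulr_ge0 ?exprn_ge0// ltW.
  have := ler_wpM2l p0 eq; rewrite [2 ^+ (m + _)]exprD -pq.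
  have a0 : (0 : R) <= 2 ^+ a by rewrite exprn_ge0.
  have e0 : (0 : R) <= 2 ^+ m * q ^+ s * expR ((n + n)%:R / q).
    by rewrite mulr_ge0 ?expR_ge0.
  lra.
move: h2; rewrite -ler_ln ?posrE ?mulr_gt0 ?exprn_gt0 ?expR_gt0//.
rewrite lnM ?posrE ?exprn_gt0 ?expR_gt0// !lnXn// expRK.
rewrite -[ln 2 *+ a]mulr_natl -[ln 2 *+ (m + _)]mulr_natl natrD natrM.
have l2 := ln2_ge_half R.
have nE' : n%:R = 10 * a%:R :> R by rewrite nE natrM.
have sn' : 320 * s%:R <= n%:R :> R by rewrite -natrM ler_nat.
(* With [m < n / 20] and [8 s <= n / 40], the exponent keeps a margin of more than [n / 10 - n / 20
   - n / 40 - n / 64 = 3 n / 320]. *)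
have mn' : 20 * (m%:R + 1) <= n%:R :> R.
  by rewrite natr1 -natrM ler_nat; lia.
have m0 : (0 : R) <= m%:R by [].
have -> : a%:R = n%:R / 10 :> R by lra.
move=> h2.
have h3 : (n + n)%:R / q <= n%:R / 64 * ln 2 :> R.
  have n0 : (0 : R) <= n%:R by [].
  have : 0 <= n%:R * (ln 2 - 1 / 2) :> R by rewrite mulr_ge0//; lra.
  rewrite ler_pdivrMr// qE natrD; lra.
have h4 : (n%:R / 10 - m%:R - 8 * s%:R - n%:R / 64) * ln 2 <= 0 :> R by lra.
have h5 : 0 < n%:R / 10 - m%:R - 8 * s%:R - n%:R / 64 :> R by lra.
nra.
Qed.

(** The numbers for Markov's inequality: [x + y <= 4 d <= 1 / 640] and [n <= 320 (s + 1)], so many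
    errors have probability [1 - z] at most 1/2. *)
Lemma half_le_few_errors (R : realType) (n s : nat) (x y z d : R) :
  320 * (8 * d) <= 1 -> x <= 3 * d -> y <= d -> n%:R <= 320 * s.+1%:R :> R ->
  s.+1%:R * (1 - z) <= n%:R * (x + y) -> 1 / 2 <= z.
Proof.
move=> hd hx hy ns hz; have s0 : (0 : R) < s.+1%:R by rewrite ltr0n.
have h1 : n%:R * (x + y) <= n%:R * (1 / 640) by rewrite ler_wpM2l//; lra.
have h2 : s.+1%:R * (1 - z) <= s.+1%:R * (1 / 2) by lra.
by move: h2; rewrite ler_pM2l//; lra.
Qed.

Lemma not_future_independent (R : realType) (d : R)
    (eta : probability (Sigma * Sigma)%type R) :
  0 < d -> 320 * (8 * d) <= 1 ->
  Defs.invariant block_shift eta -> pr eta (~` agree) <= d ->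
  ~ future_independent block_shift eta.
Proof.
move=> d0 hd inv dis fi.
have mX := measurable_block_shift.
have [B mB hB] := future_independent_predictor mX zero_notin_block_shift fi.
pose Q : probability SigmaM R := distribution eta past_base.
(* The predictor is replaced by one that reads a finite part of the past, at the cost of a further
   error [d]. *)
have [E [se hE] hBE] := findep_approx Q mB d0.
pose m := (\max_(j <- se) j).+1.
have se_lt j : j \in se -> (j < m)%N.
  by move=> js; rewrite ltnS; exact: (@leq_bigmax_seq _ _ xpredT).
have mE := measurable_findep hE.
have mpre (C : set SigmaM) : measurable C -> measurable (past_base @^-1` C).
  by move=> mC; rewrite -[X in measurable X]setTI; exact: measurable_past_base.
have mD : measurable (~` agree) by apply: measurableC; exact: measurable_agree.
pose bad : set (Sigma * Sigma) := [set x | x.2 0 != `[< B (past_base x) >]].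
have mbad : measurable bad.
  have m0 b : measurable [set x : Sigma * Sigma | x.2 0 = b].
    rewrite (_ : mkset _ = setT `*` [set t : Sigma | t 0 = b]).
      by apply: measurableX => //; exact: measurable_coord.
    by apply/seteqP; split=> -[w t] //= [].
  rewrite (_ : bad = ([set x | x.2 0 = true] `&` ~` (past_base @^-1` B))
    `|` ([set x | x.2 0 = false] `&` (past_base @^-1` B))).
    apply: measurableU; apply: measurableI => //; last exact: mpre.
    by apply: measurableC; exact: mpre.
  apply/seteqP; split=> x; rewrite /bad /=.
    by case: (x.2 0); case: asboolP => // h _; [left|right].
  by case=> -[-> h]; case: asboolP.
have mS := measurable_symdiff mB mE.
have hH : pr eta (mispredicted E) <= 3 * d.
  have -> : 3 * d = d + d + d by lra.
  (* If [E] mispredicts [w_0], then [w_0] differs from [t_0], or [B] mispredicts [t_0], or [B] and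
     [E] differ at this past. *)
  apply: (@le_trans _ _ (pr eta (~` agree) + pr eta bad
      + pr eta (past_base @^-1` symdiff B E))); last first.
    by rewrite lerD// lerD// (le_trans hB).
  rewrite (le_trans _ (lerD (prU_le eta mD mbad) (lexx _)))//.
  rewrite (le_trans _ (prU_le eta (measurableU _ _ mD mbad) (mpre _ mS)))//.
  apply: pr_le.
  - exact: measurable_mispredicted.
  - by apply: measurableU; [exact: measurableU|exact: mpre].
  - move=> x; rewrite /mispredicted /bad /agree /symdiff /setU /setD /setC /preimage /=.
    case: (x.1 0); case: (x.2 0);
      case: (asboolP (B (past_base x))) => Bx; case: (asboolP (E (past_base x))) => Ex;
      move=> //= _; first [by left; left | by left; right | by right; left
        | by right; right].
pose k := (10 * m.+1)%N; have mk : (10 * m.+1 <= k)%N by [].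
pose n := (2 * blen k)%N; pose s := (n %/ 320)%N.
have sn : (320 * s <= n)%N by rewrite mulnC leq_trunc_div.
have [q qE] : exists q : R, q = 2 ^+ 8 by exists (2 ^+ 8).
have q1 : 1 <= q by rewrite qE exprn_ege1// ler1n.
apply: (few_words_contradiction qE mk sn).
apply: le_trans (pr_few_errors_le inv hE se_lt k s q1).
have := pr_many_errors inv m hE n s.
rewrite prC; last exact: (measurable_few_errors m hE).
have ns : n%:R <= 320 * s.+1%:R :> R.
  by rewrite -natrM ler_nat ltnW// mulnC ltn_ceil.
exact: half_le_few_errors hd hH dis ns.
Qed.

Theorem propositionA1 (R : realType) :
  exists (X : set Sigma) (phi : Sigma * Sigma -> R),
    [/\ subshift X,
        hoelder_on X phi,
        exists f : bool -> bool -> R,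
          forall (w t : Sigma), X t -> phi (w, t) = f (w 0) (t 0),
        forall eta : probability (Sigma * Sigma)%type R,
          poe_maximizer X phi eta -> ~ future_independent X eta
      & let S := ereal_sup
          [set (ks_entropy left_shift (distribution eta base) + energy X phi eta)%E
          | eta in ergodic X] in
        (poe X phi < S)%E /\ (S <= top_pressure X phi)%E].
Proof.
(* Chosen so that [d = 2 / K] satisfies [320 * (8 * d) <= 1]. *)
have [K hK] : exists K : R, 320 * (8 * 2) <= K by exists (320 * (8 * 2)).
have K0 : 0 < K by lra.
exists block_shift, (coupling K); split.
- split; [exact: block_shift_nonempty|exact: compact_block_shift|].
  exact: image_block_shift.
- exact/hoelder_coupling/ltW.
- by exists (fun a b => if a == b then K else 0).
- move=> eta max; apply: (@not_future_independent _ (2 / K)).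
  + by rewrite divr_gt0.
  + by rewrite !mulrA ler_pdivrMr// mul1r -!mulrA.
  + by case: max.
  + exact: poe_maximizer_disagree.
split; last exact: le_top_pressure.
have [eta [erg agr hks]] := ergodic_diagonal_ex R.
(* The excess of the POE bound over [K] is [ln (1 + e^-K) <= e^-K <= 1 / 21], and
   [ln 2 / 10 >= 1 / 20]. *)
apply: (@lt_le_trans _ _ (ln 2 / 10 + K)%:E).
  apply: (le_lt_trans (poe_coupling_le _ (ltW K0))); rewrite lte_fin.
  have eK := expR_gt0 K.
  have -> : 1 + expR K = expR K * (1 + (expR K)^-1).
    by rewrite mulrDr mulr1 mulfV ?gt_eqF// addrC.
  have iK : 0 < (expR K)^-1 by rewrite invr_gt0.
  rewrite lnM ?posrE ?addr_gt0// expRK addrC ltrD2r.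
  have l1 : ln (1 + (expR K)^-1) <= (expR K)^-1 by apply: le_ln1Dx; lra.
  have l2 : (expR K)^-1 <= 21^-1.
    rewrite lef_pV2 ?posrE//; have := @expR_ge1Dx R K; lra.
  have := ln2_ge_half R; lra.
apply: (@le_trans _ _ (ks_entropy left_shift (distribution eta base)
    + energy block_shift (coupling K) eta)%E).
  rewrite (energy_coupling (ltW K0) measurable_block_shift erg.1.1) agr mulr1.
  by rewrite EFinD leeD2r.
by apply: ereal_sup_ubound; exists eta.
Qed.
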